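(* Under partial information feedback, when $v_1,\dots,v_T$ are sampled i.i.d. from some distribution $F$ on $[0,\bar v]$, there is a constant $C$ such that with probability at least $1-4/T$, the OGD-CB algorithm $\beta$ guarantees \[\mathrm{OPT}-R^\beta(\bm v,\bm p)\le C\sqrt{T\ln T}.\]
   Context: Model: constants $\bar v>0$, $\rho\in(0,\bar v]$; $T$ rounds; budget $B=\rho T$. Round $t$: value $v_t\in[0,\bar v]$; highest competing bid $p_t$ i.i.d. from an unknown distribution $G$ on $[0,\bar v]$, independent of values. Buyer chooses $x_t\in\{0,1\}$, receives $x_tr_t$ with $r_t=(v_t-p_t)^+$, pays $x_tc_t$ with $c_t=p_t\mathbf 1[v_t\ge p_t]$. Partial information feedback: $p_t$ is observed only when $x_t=1$. Revenue $R^\beta(\bm v,\bm p)=\sum_{t=1}^{T_0}x_tr_t$, $T_0$ the ending time. $\mathrm{OPT}=T\max_{\pi:[0,\bar v]\to[0,1]}\mathbb E_{v\sim F,p\sim G}[\pi(v)(v-p)^+]$ s.t. $\mathbb E_{v\sim F,p\sim G}[\pi(v)p\mathbf 1[v\ge p]]\le\rho$. OGD-CB algorithm: $\mathcal I_1=\emptyset$, $B_1=B$, $\lambda_1=0$. For $t=1,\dots,T$: observe $v_t$. If $t=1$: $x_1=1$, $\lambda_2=\lambda_1$. Otherwise: $\epsilon_t=\sqrt{(\ln 2+2\ln T)/(2|\mathcal I_t|)}$; $\tilde r_t(v)=\frac1{|\mathcal I_t|}\sum_{\tau\in\mathcal I_t}(v-p_\tau)^++\epsilon_tv$; $\tilde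 c_t(v)=\frac1{|\mathcal I_t|}\sum_{\tau\in\mathcal I_t}p_\tau\mathbf 1[v\ge p_\tau]-2\epsilon_tv$; $x_t=\mathbf 1[\tilde r_t(v_t)\ge\lambda_t\tilde c_t(v_t)]$; $\eta_t=1/(\bar v\sqrt t)$; $\lambda_{t+1}=(\lambda_t+\eta_t(x_t\tilde c_t(v_t)-\rho))^+$. If $x_t=1$, observe $p_t$ and set $\mathcal I_{t+1}=\mathcal I_t\cup\{t\}$, else $\mathcal I_{t+1}=\mathcal I_t$. Set $B_{t+1}=B_t-x_tc_t$; if $B_{t+1}<\bar v$, stop; $T_0$ is the stopping round (or $T$). *)

(* Defs.v *)
From HB Require Import structures.
From mathcomp Require Import all_boot all_order all_algebra.
From mathcomp Require Import all_classical all_reals.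
From mathcomp Require Import ereal exp measure lebesgue_measure lebesgue_integral probability.
Set Implicit Arguments. Unset Strict Implicit. Unset Printing Implicit Defensive.
Import Order.TTheory GRing.Theory Num.Theory.
Local Open Scope classical_set_scope.
Local Open Scope ring_scope.

Section Defs.
Variable R : realType.

Definition pos_part (x : R) : R := Num.max x 0.

Definition reward (v p : R) : R := pos_part (v - p).
Definition cost (v p : R) : R := if p <= v then p else 0.

(* state of OGD-CB before round t:
   lambda_t, observed competing bids {p_tau : tau in I_t}, budget B_t,
   stopped flag, accumulated revenue *)
Record ogd_state := OgdState {
  st_lam : R; st_obs : seq R; st_budget : R; st_stopped : bool; st_rev : R }.

Definition mean_over (obs : seq R) (f : R -> R) : R :=
  (\sum_(q <- obs) f q) / (size obs)%:R.

Definition ogd_step (vbar rho : R) (T : nat) (v p : nat -> R)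
  (s : ogd_state) (t : nat) : ogd_state :=
  if st_stopped s then s else
  let vt := v t in let pt := p t in
  let lam := st_lam s in let obs := st_obs s in
  let xl : bool * R :=
    if t == 1%N then (true, lam) else
    let n := size obs in
    let eps := Num.sqrt ((ln 2 + 2 * ln T%:R) / (2 * n%:R)) in
    let rt := mean_over obs (fun q => pos_part (vt - q)) + eps * vt in
    let ct := mean_over obs (fun q => if q <= vt then q else 0) - 2 * eps * vt in
    let x := lam * ct <= rt in
    let eta := (vbar * Num.sqrt t%:R)^-1 in
    (x, Num.max (lam + eta * ((if x then ct else 0) - rho)) 0) in
  let x := xl.1 in
  let obs' := if x then pt :: obs else obs in
  let B' := st_budget s - (if x then cost vt pt else 0) in
  let rev' := st_rev s + (if x then reward vt pt else 0) in
  OgdState xl.2 obs' B' (B' < vbar) rev'.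

Definition ogd_revenue (vbar rho : R) (T : nat) (v p : nat -> R) : R :=
  st_rev (foldl (ogd_step vbar rho T v p)
                (OgdState 0 [::] (rho * T%:R) false 0) (iota 1 T)).

(* OPT = T * sup_pi E_{v~F,p~G}[pi(v)(v-p)^+]
         s.t. E_{v~F,p~G}[pi(v) p 1[v>=p]] <= rho,
   the expectation over independent v ~ F, p ~ G written as an iterated integral *)
Definition OPT (F G : probability R R) (rho : R) (T : nat) : \bar R :=
  (T%:R%:E * ereal_sup
    [set (\int[F]_x (EFin (pol x) * \int[G]_y EFin (reward x y)))%E
    | pol in [set pol : R -> R | measurable_fun setT pol
                              /\ (forall x, (0 <= pol x <= 1)%R)
                              /\ (\int[F]_x (EFin (pol x) * \int[G]_y EFin (cost x y))
                                    <= rho%:E)%E]])%E.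

Definition mutually_independent d (Omega : measurableType d)
  (P : probability Omega R) (I : eqType) (s : seq I) (X : I -> Omega -> R) : Prop :=
  forall B : I -> set R, (forall i, measurable (B i)) ->
    P (\bigcap_(i in [set` s]) (X i @^-1` B i)) = (\prod_(i <- s) P (X i @^-1` B i))%E.

Definition vp_family d (Omega : measurableType d) (v p : nat -> Omega -> R)
  (i : nat + nat) : Omega -> R :=
  match i with inl t => v t | inr t => p t end.

End Defs.

(* Main.v *)
(* The optimism built into the algorithm is not needed.  In a round without
   purchase lambda decreases, and lambda = 0 forces a purchase; a potential
   argument then shows, for every sequence of values and prices, that a buyer
   still active after k rounds has bought at least (rho / (7 vbar))^2 k times.
   Hence eps_t and the estimation errors at v_t are O(sqrt (ln T / t)), which
   sums to O(sqrt (T ln T)), and since v_t is independent of the prices a crude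
   Azuma inequality for fixed v_t replaces uniform (DKW) concentration.  The
   multiplier lambda stays bounded, also deterministically.

   For the regret let H(l) = E_v (r(v) - l c(v))^+, where r and c are the mean
   reward and cost; weak duality gives OPT / T <= H(l) + l rho for all l >= 0.
   In each active round the rule for x_t yields, up to the estimation error,
   x_t r(v_t) >= (r(v_t) - lambda_t c(v_t))^+ + lambda_t x_t c~_t, and gradient
   ascent with g_t = x_t c~_t - rho gives
   sum lambda_t g_t >= u sum g_t - O(sqrt T).  Taking u = vbar / rho if the budget
   runs out and u = 0 otherwise pays for the rounds lost after stopping. *)

Require Import Defs.
From HB Require Import structures.
From mathcomp Require Import all_boot all_order all_algebra.
From mathcomp Require Import all_classical all_reals.
From mathcomp Require Import ereal exp measure lebesgue_measure lebesgue_integral probability.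
From mathcomp Require Import sequences numfun measurable_realfun.
From mathcomp Require Import ring lra.
Set Implicit Arguments. Unset Strict Implicit. Unset Printing Implicit Defensive.
Import Order.TTheory GRing.Theory Num.Theory.
Local Open Scope classical_set_scope.
Local Open Scope ring_scope.

(** * Exponential moments and the past of a family of independent variables *)

(** Whether a price is observed depends on earlier observations, so the sample is not i.i.d. and its
    size is random. The obstacle disappears for unnormalised sums over rounds, in which a price
    enters with the 0/1 weight of its purchase: this weight is settled before the price is drawn, so
    the centred sums are martingales. The random sample size appears only in a final division, where
    the deterministic lower bound on purchases replaces it; no union bound over sample sizes arises.
    Two filtrations occur. Prices are revealed after all the values; for the dual function, rounds
    are revealed one by one, since lambda_t must be known when v_t is drawn and v_t must not be.
    Probability is confined to T bad events of measure at most 4 / T^3; off them the regret bound is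
    an inequality between real numbers. As the laws place values and prices in [0, vbar] only almost
    surely, the process is clipped, which changes it on a null set. *)

(** Integrated over a centred variable, the linear term vanishes and a sub-Gaussian moment bound
    remains. The factor 4 settles x >= 1/4 at once, as then 4 x^2 >= x; below 1/4 the bound exp x <=
    1 + x + x^2 suffices. *)
Lemma expR_le_idD_expR_sqr (R : realType) (x : R) :
  expR x <= x + expR (4 * x ^+ 2).
Proof.
have exp_inv (y : R) : y < 1 -> expR y <= (1 - y)^-1.
  move=> y1; rewrite -[y]opprK expRN opprK lef_pV2 ?posrE ?expR_gt0 ?subr_gt0//.
  exact: expR_ge1Dx.
have quad := expR_ge1Dx (4 * x ^+ 2).
have [x0|x0] := leP x 0.
  suff : expR x <= 1 + x + x ^+ 2 by have := sqr_ge0 x; nra.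
  apply: le_trans (exp_inv _ _) _; first lra.
  by rewrite -div1r ler_pdivrMr; nra.
have [x4|x4] := leP (1 / 4) x.
  apply: (@le_trans _ _ (expR (4 * x ^+ 2))); last by lra.
  by rewrite ler_expR; nra.
suff : expR x <= 1 + x + x ^+ 2 by have := sqr_ge0 x; nra.
(* For x > 0 the bound 1 / (1 - x) already exceeds 1 + x + x^2; squaring the bound at x / 2 lowers
   the quadratic coefficient to 3/4. *)
have -> : expR x = expR (x / 2) ^+ 2 by rewrite -expRM_natr -mulrA mulVf ?mulr1.
have h1 : expR (x / 2) <= (1 - x / 2)^-1 by apply: exp_inv; lra.
have h2 : expR (x / 2) ^+ 2 <= (1 - x / 2)^-1 ^+ 2.
  by rewrite lerXn2r ?nnegrE ?expR_ge0// invr_ge0; lra.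
apply: le_trans h2 _.
rewrite exprVn -div1r ler_pdivrMr ?exprn_gt0; try lra.
have : 0 <= x ^+ 2 * (1 - 3 * x + x ^+ 2) by apply: mulr_ge0; nra.
nra.
Qed.

Lemma bounded_integrable (d : measure_display) (T : measurableType d) (R : realType)
    (G : probability T R) (g : T -> R) (b : R) :
  measurable_fun setT g -> (forall y, `|g y| <= b) ->
  G.-integrable setT (EFin \o g).
Proof.
move=> mg gb; apply: measurable_bounded_integrable => //.
  exact: le_lt_trans (probability_le1 _ _) (ltry _).
exists b; split; first exact: num_real.
by move=> M bM y _ /=; apply: le_trans (gb y) (ltW bM).
Qed.

Lemma integral_cst_prob (d : measure_display) (T : measurableType d) (R : realType)
    (G : probability T R) (c : R) : (\int[G]_y c%:E = c%:E)%E.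
Proof. by rewrite integral_cst// [X in (_ * X)%E]probability_setT mule1. Qed.

Lemma integral_expR_le (d : measure_display) (T : measurableType d) (R : realType)
    (G : probability T R) (g : T -> R) (b : R) :
  measurable_fun setT g -> (forall y, `|g y| <= b) ->
  (\int[G]_y (g y)%:E = 0)%E ->
  (\int[G]_y (expR (g y))%:E <= (expR (4 * b ^+ 2))%:E)%E.
Proof.
move=> mg gb g0.
have ig := bounded_integrable G mg gb.
have ic : G.-integrable setT (EFin \o cst (expR (4 * b ^+ 2))).
  by apply: (bounded_integrable _ (b := expR (4 * b ^+ 2))) => // y; rewrite ger0_norm ?expR_ge0.
have -> : (expR (4 * b ^+ 2))%:E =
    (\int[G]_y ((EFin \o g) y + (EFin \o cst (expR (4 * b ^+ 2))) y))%E.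
  by rewrite integralD//= g0 add0e integral_cst_prob.
apply: ge0_le_integral => //=.
- apply/measurable_EFinP; exact: measurableT_comp.
- by apply/measurable_EFinP; apply: measurable_funD.
- move=> y _; rewrite -EFinD lee_fin.
  apply: le_trans (expR_le_idD_expR_sqr _) _; rewrite lerD2l ler_expR.
  by rewrite ler_pM2l// -(real_normK (num_real (g y))) lerXn2r ?nnegrE// (le_trans _ (gb y)).
Qed.

(** The joint law of [Z] and [Y] agrees with the product of their laws on rectangles, hence
    everywhere, and Tonelli applies. [Z] may take values in any measurable type; with [Z] the
    identity into [Omega] with the coarser sigma-algebra of the past, this plays the role of
    conditioning on the past. *)
Lemma integral_independent (d d1 d2 : measure_display) (Omega : measurableType d)
    (T1 : measurableType d1) (T2 : measurableType d2) (R : realType)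
    (P : probability Omega R) (G : probability T2 R)
    (Z : Omega -> T1) (Y : Omega -> T2) (Phi : T1 * T2 -> \bar R) :
  measurable_fun setT Z -> measurable_fun setT Y ->
  (forall A B, measurable A -> measurable B ->
     P (Z @^-1` A `&` Y @^-1` B) = (P (Z @^-1` A) * G B)%E) ->
  measurable_fun setT Phi -> (forall z, 0 <= Phi z)%E ->
  (\int[P]_w Phi (Z w, Y w) = \int[P]_w \int[G]_y Phi (Z w, y))%E.
Proof.
move=> mZ mY ZY mPhi Phi0.
have mZY : measurable_fun setT (fun w => (Z w, Y w)) by exact: measurable_fun_pair.
pose Z' : {mfun Omega >-> T1} := HB.pack Z (isMeasurableFun.Build _ _ _ _ Z mZ).
pose W : {mfun Omega >-> (T1 * T2)%type} :=
  HB.pack (fun w => (Z w, Y w)) (isMeasurableFun.Build _ _ _ _ _ mZY).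
have eW : forall X, measurable X -> (distribution P Z' \x G)%E X = distribution P W X.
  apply: product_measure_unique => A B mA mB.
  by rewrite /distribution /pushforward /= -ZY.
transitivity (\int[distribution P W]_z Phi z)%E.
  by rewrite ge0_integral_pushforward.
rewrite (eq_measure_integral (distribution P Z' \x G)%E); last first.
  by move=> X mX _; exact/esym/eW.
rewrite fubini_tonelli1//= /fubini_F ge0_integral_pushforward//.
- exact: measurable_fun_fubini_tonelli_F.
- by move=> ? _; apply: integral_ge0.
Qed.

(** * Independence of a new variable from the sigma-algebra of the past *)

Section IndependentPast.
Context (d : measure_display) (Omega : measurableType d) (R : realType).
Context (P : probability Omega R) (I : eqType) (s : seq I) (X : I -> Omega -> R).

(* Cylinders constrain only the coordinates in J, B i = setT elsewhere; they generate the
   sigma-algebra of (X i)_(i in s, J i) as a measurable structure on Omega itself. *)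
Definition past_cylinders (J : pred I) : set (set Omega) :=
  [set A | exists B : I -> set R, [/\ forall i, measurable (B i),
     forall i, ~~ J i -> B i = setT & A = \bigcap_(i in [set` s]) (X i @^-1` B i)]].

Definition past (J : pred I) := g_sigma_algebraType (past_cylinders J).

Hypothesis mX : forall i, measurable_fun setT (X i).

Lemma past_cylinders_measurable (J : pred I) : past_cylinders J `<=` measurable.
Proof.
move=> _ [B [mB _ ->]]; apply: fin_bigcap_measurable; first exact: finite_seq.
by move=> i _; rewrite -[X in measurable X]setTI; exact: mX.
Qed.

Lemma past_measurableS (J : pred I) : <<s past_cylinders J >> `<=` measurable.
Proof.
apply: smallest_sub; last exact: past_cylinders_measurable.
exact: sigma_algebra_measurable.
Qed.

Lemma past_cylindersI (J : pred I) : setI_closed (past_cylinders J).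
Proof.
move=> _ _ [B [mB BJ ->]] [C [mC CJ ->]]; exists (fun i => B i `&` C i); split.
- by move=> i; apply: measurableI.
- by move=> i iJ; rewrite BJ ?CJ ?setTI.
- by rewrite -bigcapI; apply: eq_bigcapr => i _; rewrite preimage_setI.
Qed.

Lemma measurable_past_id (J : pred I) :
  measurable_fun setT (id : Omega -> past J).
Proof. by move=> _ A mA; rewrite setTI; exact: (past_measurableS mA). Qed.

Lemma measurable_past_var (J : pred I) (i : I) : i \in s -> J i ->
  measurable_fun setT (X i : past J -> R).
Proof.
move=> si Ji _ B mB; rewrite setTI; apply: sub_sigma_algebra.
exists (fun j => if j == i then B else setT); split.
- by move=> j; case: ifP.
- by move=> j; case: eqP => // ->; rewrite Ji.
- apply/seteqP; split => [w Bw j _|w /(_ i si)] /=; last by rewrite eqxx.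
  by case: eqP => // ji; rewrite ji; exact: Bw.
Qed.

Lemma measurable_past_sub (d' : measure_display) (T : measurableType d')
    (J K : pred I) (f : Omega -> T) : {subset J <= K} ->
  measurable_fun setT (f : past J -> T) -> measurable_fun setT (f : past K -> T).
Proof.
move=> JK mf _ B mB; have := mf measurableT B mB; rewrite !setTI.
apply: sub_sigma_algebra2 => _ [C [mC CJ ->]]; exists C; split => // i iK.
by apply: CJ; apply: contra iK => /JK.
Qed.

Hypothesis s_uniq : uniq s.
Hypothesis X_indep : mutually_independent P s X.

(** Both sides are finite measures in [A], so it suffices to compare them on the pi-system of
    cylinders. There coordinate [i] is unconstrained because it lies outside [J]; placing [B] at
    that coordinate gives another finite intersection, to which the product rule applies. *)
Lemma past_independent (J : pred I) (i : I) (A : set Omega) (B : set R) :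
  i \in s -> ~~ J i -> <<s past_cylinders J >> A -> measurable B ->
  P (A `&` X i @^-1` B) = (P A * P (X i @^-1` B))%E.
Proof.
move=> si Ji sA mB.
have mXB : measurable (X i @^-1` B).
  by rewrite -[X in measurable X]setTI; exact: mX.
pose c : {nonneg R} := NngNum (fine_ge0 (measure_ge0 P (X i @^-1` B))).
have cE : c%:num%:E = P (X i @^-1` B) by rewrite /c /= fineK ?fin_num_measure.
have mA : measurable A by exact: past_measurableS sA.
rewrite -cE muleC -[RHS]/(mscale c P A) -[LHS]/(mrestr P mXB A).
apply: (g_sigma_algebra_measure_unique _ _ (fun=> setT)) sA.
- exact: past_cylinders_measurable.
- move=> _; exists (fun=> setT); split => //.
  by apply/seteqP; split => w.
- by apply: bigcup_const; exists 0%N.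
- exact: past_cylindersI.
- move=> _ [C [mC CJ ->]]; rewrite /= /mrestr /mscale /= -/c cE.
  have Ci : C i = setT by exact: CJ.
  pose D j := if j == i then B else C j.
  have -> : \bigcap_(j in [set` s]) (X j @^-1` C j) `&` X i @^-1` B =
            \bigcap_(j in [set` s]) (X j @^-1` D j).
    apply/seteqP; split => [w [Cw Bw] j sj|w Dw].
      by rewrite /D; case: eqP => [->//|_]; exact: Cw.
    split => [j sj|]; last by have := Dw _ si; rewrite /D eqxx.
    by have := Dw _ sj; rewrite /D; case: eqP => // -> _; rewrite Ci.
  rewrite !X_indep//; last by move=> j; rewrite /D; case: ifP.
  rewrite (bigD1_seq i)//= [in RHS](bigD1_seq i)//= Ci preimage_setT probability_setT mul1e.
  rewrite /D eqxx; congr (_ * _)%E; apply: eq_bigr => j /negbTE ji.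
  by rewrite ji.
- move=> _; apply: le_lt_trans (probability_le1 _ _) (ltry _).
  exact: measurableI.
Qed.

End IndependentPast.

(** * An Azuma inequality for bounded martingale differences *)

Section MartingaleTail.
Context (d : measure_display) (Omega : measurableType d) (R : realType).
Context (P : probability Omega R) (I : eqType) (s : seq I) (X : I -> Omega -> R).
Hypothesis mX : forall i, measurable_fun setT (X i).
Hypothesis s_uniq : uniq s.
Hypothesis X_indep : mutually_independent P s X.

Variables (G : probability R R) (J : nat -> pred I) (i : nat -> I) (n : nat).
Variables (psi : nat -> Omega * R -> R) (b : R).
Hypothesis i_s : forall k, (k < n)%N -> i k \in s.
Hypothesis iJ : forall k, (k < n)%N -> ~~ J k (i k).
Hypothesis iJS : forall k, (k < n)%N -> J k.+1 (i k).
Hypothesis JS : forall k, {subset J k <= J k.+1}.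
Hypothesis law_i : forall k, (k < n)%N -> forall B, measurable B -> P (X (i k) @^-1` B) = G B.
Hypothesis mpsi : forall k, (k < n)%N ->
  measurable_fun setT (psi k : past s X (J k) * R -> R).
Hypothesis psi_b : forall k z, (k < n)%N -> `|psi k z| <= b.
Hypothesis psi0 : forall k w, (k < n)%N -> (\int[G]_y (psi k (w, y))%:E = 0)%E.

Let S (m : nat) (w : Omega) : R := \sum_(k < m) psi k (w, X (i k) w).

Let measurable_S m : (m <= n)%N -> measurable_fun setT (S m : past s X (J m) -> R).
Proof.
elim: m => [|m IH] mn.
  rewrite [S 0](_ : _ = cst 0); first exact: measurable_cst.
  by apply/funext => w; rewrite /S big_ord0.
rewrite [S m.+1](_ : _ = S m \+ (fun w => psi m (w, X (i m) w))); last first.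
  by apply/funext => w; rewrite /S big_ord_recr.
apply: (@measurable_funD _ (past s X (J m.+1))).
  by apply: (measurable_past_sub (@JS m)); exact: IH (ltnW mn).
apply: (@measurableT_comp _ _ _ _ (past s X (J m) * R)%type).
  exact: mpsi.
apply: measurable_fun_pair.
  apply: (measurable_past_sub (@JS m)); exact: measurable_id.
by apply: measurable_past_var; [exact: i_s|exact: iJS].
Qed.

(** [X (i m)] is independent of the past [J m] and joins it at step m + 1, so it can be integrated
    out with the first m terms frozen. As [psi m] is centred and bounded by b, each step costs one
    factor exp (4 (t b)^2). *)
Let mgf_S (t : R) m : (m <= n)%N ->
  (\int[P]_w (expR (t * S m w))%:E <= (expR (4 * (t * b) ^+ 2 * m%:R))%:E)%E.
Proof.
elim: m => [|m IH] mn.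
  under eq_integral do rewrite /S big_ord0 mulr0.
  by rewrite integral_cst_prob mulr0.
have mSm := measurable_S (ltnW mn).
pose T1 := past s X (J m).
pose Phi (z : T1 * R) := (expR (t * S m z.1) * expR (t * psi m z))%:E.
have mPsi : measurable_fun setT (psi m : (T1 * R)%type -> R) by exact: mpsi.
have mPhi : measurable_fun setT Phi.
  apply/measurable_EFinP; apply: measurable_funM.
    apply: measurableT_comp => //; apply: measurable_funM => //.
    by apply: (@measurableT_comp _ _ _ _ T1) => //; exact: measurable_fst.
  apply: measurableT_comp => //; exact: measurable_funM.
have Phi0 z : (0 <= Phi z)%E by rewrite lee_fin mulr_ge0 ?expR_ge0.
have -> : (\int[P]_w (expR (t * S m.+1 w))%:E = \int[P]_w Phi (w, X (i m) w))%E.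
  apply: eq_integral => w _; rewrite /Phi /= -expRD -mulrDr.
  by rewrite /S big_ord_recr.
have -> : (\int[P]_w Phi (w, X (i m) w) = \int[P]_w \int[G]_y Phi (w, y))%E.
  apply: (@integral_independent _ _ _ _ T1 _ _ P G id (X (i m)) Phi) => //.
  - exact: measurable_past_id.
  - move=> A B mA mB; rewrite -(law_i mn)//.
    by apply: (past_independent mX s_uniq X_indep (i_s mn) (iJ mn)).
have inner w : (\int[G]_y Phi (w, y) <=
    (expR (4 * (t * b) ^+ 2))%:E * (expR (t * S m w))%:E)%E.
  under eq_integral do rewrite /Phi /= EFinM.
  have mpw : measurable_fun setT (fun y => t * psi m (w, y)).
    apply: measurable_funM => //.
    exact: (measurableT_comp mPsi (measurable_pair1 w)).
  rewrite ge0_integralZl//; last first.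
    by apply/measurable_EFinP; exact: measurableT_comp.
  rewrite muleC lee_wpmul2r ?lee_fin ?expR_ge0//.
  have -> : (t * b) ^+ 2 = (`|t| * b) ^+ 2 by rewrite !exprMn real_normK ?num_real.
  apply: integral_expR_le => //.
    by move=> y; rewrite normrM ler_wpM2l ?psi_b.
  under eq_integral do rewrite EFinM.
  rewrite integralZl//; first by rewrite psi0// mule0.
  apply: (bounded_integrable _ (b := b)); last by move=> y; exact: psi_b.
  exact: (measurableT_comp mPsi (measurable_pair1 w)).
have mS : measurable_fun setT (S m).
  exact: (measurableT_comp mSm (measurable_past_id mX (J := J m))).
apply: (@le_trans _ _
  (\int[P]_w ((expR (4 * (t * b) ^+ 2))%:E * (expR (t * S m w))%:E))%E).
  apply: ge0_le_integral => //.
  - by move=> w _; apply: integral_ge0.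
  - have mF := @measurable_fun_fubini_tonelli_F _ _ T1 _ _ G Phi mPhi Phi0.
    exact: (measurableT_comp mF (measurable_past_id mX (J := J m))).
  - apply: emeasurable_funM => //; apply/measurable_EFinP.
    by apply: measurableT_comp => //; apply: measurable_funM.
rewrite ge0_integralZl//; last first.
  apply/measurable_EFinP.
  by apply: measurableT_comp => //; apply: measurable_funM.
apply: le_trans (lee_wpmul2l _ (IH (ltnW mn))) _; first by rewrite lee_fin expR_ge0.
by rewrite -EFinM -expRD -[m.+1%:R]natr1 mulrDr mulr1 addrC.
Qed.

Lemma measurable_martingale :
  measurable_fun setT (fun w => \sum_(k < n) psi k (w, X (i k) w)).
Proof.
exact: (measurableT_comp (measurable_S (leqnn n)) (measurable_past_id mX (J := J n))).
Qed.

(** Chernoff's bound at t = sqrt (L / m) / b: t times the threshold is 7 L, while the moment bound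
    contributes at most 4 L, which leaves 3 L. With L = ln T the probability is T^-3, small enough
    for a union over O(T) events. *)
Lemma martingale_tail (m : nat) (L : R) : 0 < b -> 0 < L -> (0 < m)%N -> (n <= m)%N ->
  (P [set w | (7 * b * Num.sqrt (m%:R * L) <= \sum_(k < n) psi k (w, X (i k) w))%R]
    <= (expR (- (3 * L)))%:E)%E.
Proof.
move=> b0 L0 m0 nm.
have m0' : 0 < m%:R :> R by rewrite ltr0n.
pose t := Num.sqrt (L / m%:R) / b.
pose a := 7 * b * Num.sqrt (m%:R * L).
have t0 : 0 < t by rewrite divr_gt0// sqrtr_gt0 divr_gt0.
have ta : t * a = 7 * L.
  rewrite /t /a (sqrtrM _ (ltW L0)) (sqrtrM _ (ltW m0')) sqrtrV ?ltW//.
  have := sqr_sqrtr (ltW L0); have : 0 < Num.sqrt (m%:R : R) by rewrite sqrtr_gt0.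
  move: (Num.sqrt L) (Num.sqrt _) => x y y0 <-.
  by field; rewrite !gt_eqF.
have tb : 4 * (t * b) ^+ 2 * n%:R <= 4 * L.
  have Lm : L / m%:R * n%:R <= L.
    by rewrite mulrAC ler_pdivrMr// ler_pM2l// ler_nat.
  have Lm0 : 0 <= L / m%:R by apply: divr_ge0; exact: ltW.
  by rewrite /t divfK ?gt_eqF// sqr_sqrtr// -mulrA ler_pM2l.
have mS := measurable_martingale.
have mE : measurable_fun setT (fun w => (expR (t * S n w))%:E).
  by apply/measurable_EFinP; apply: measurableT_comp => //; apply: measurable_funM.
apply: (@le_trans _ _ ((expR (- (t * a)))%:E * \int[P]_w (expR (t * S n w))%:E)%E).
  rewrite expRN -lee_pdivrMl ?invr_gt0 ?expR_gt0// invrK.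
  set E := [set w | _]; have mEv : measurable E.
    by rewrite -[E]setTI; apply: measurable_fun_le.
  have -> : (\int[P]_w (expR (t * S n w))%:E = \int[P]_w `|(expR (t * S n w))%:E|)%E.
    by apply: eq_integral => w _; rewrite gee0_abs// lee_fin expR_ge0.
  apply: le_trans (le_integral_abse P measurableT mE (expR_gt0 (t * a))).
  apply: lee_wpmul2l; first by rewrite lee_fin expR_ge0.
  apply: le_measure; rewrite ?inE//.
    apply: emeasurable_fun_c_infty => //; exact: measurableT_comp.
  move=> w Ew; split => //=; rewrite lee_fin ger0_norm ?expR_ge0//.
  by rewrite ler_expR ler_pM2l.
apply: le_trans (lee_wpmul2l _ (mgf_S t (leqnn n))) _; first by rewrite lee_fin expR_ge0.
by rewrite -EFinM -expRD lee_fin ler_expR ta; lra.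
Qed.

End MartingaleTail.

(** * Online gradient ascent *)

Section OnlineGradientCount.
Variables (R : realType) (V rho : R) (m : nat).
Variables (lam ct : nat -> R) (x : nat -> bool).
Hypotheses (V0 : 0 < V) (rho0 : 0 < rho) (rhoV : rho <= V).
Hypotheses (x0 : x 0) (lam1 : lam 1 = 0).
Hypothesis lamS : forall k, (0 < k < m)%N -> lam k.+1 =
  Num.max (lam k + (V * Num.sqrt k.+1%:R)^-1 * ((if x k then ct k else 0) - rho)) 0.
Hypothesis ctV : forall k, (0 < k < m)%N -> ct k <= V.
Hypothesis x_lam0 : forall k, (0 < k < m)%N -> lam k = 0 -> x k.

Let N k := (\sum_(j < k) x j)%N.

Let N_le k : (N k <= k)%N.
Proof.
rewrite /N -[X in (_ <= X)%N]card_ord -sum1_card leq_sum// => j _.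
exact: leq_b1.
Qed.

Let lam_ge0 k : (0 < k <= m)%N -> 0 <= lam k.
Proof.
case: k => // -[|k] /andP[_ km]; first by rewrite lam1.
by rewrite lamS// le_max lexx orbT.
Qed.

Let e k : R := (Num.sqrt k%:R)^-1.

(* The last term absorbs the truncation at 0, after which a purchase is forced. *)
Let count_invariant k : (0 < k <= m)%N ->
  rho * (\sum_(j < k) e j.+1) + V * lam k <=
  6 * V * Num.sqrt (N k)%:R + (if lam k == 0 then rho * e k else 0).
Proof.
elim: k => [//|[|k] IH] km.
  rewrite big_ord1 /N big_ord1 x0 lam1 eqxx mulr0 addr0 lerDr.
  by rewrite !mulr_ge0 ?sqrtr_ge0// ltW.
have km' : (0 < k.+1 < m)%N by case/andP: km.
have {}IH : (0 < k.+1 <= m)%N -> _ := IH.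
have := IH _; rewrite (ltnW (proj2 (andP km')))// => /(_ isT) {}IH.
have lk : 0 <= lam k.+1 by apply: lam_ge0; case/andP: km' => _ /ltnW ->.
have s1 : 0 < Num.sqrt (k.+1%:R : R) by rewrite sqrtr_gt0.
have s2 : 0 < Num.sqrt (k.+2%:R : R) by rewrite sqrtr_gt0.
have e2 : 0 < e k.+2 by rewrite invr_gt0.
have e12 : e k.+1 <= 2 * e k.+2.
  rewrite /e -div1r -[2 * _]/(2 / _) ler_pdivrMr// mulrAC ler_pdivlMr// mul1r.
  rewrite -(@ler_sqr _ (Num.sqrt _)) ?nnegrE ?mulr_ge0 ?ltW//.
  rewrite exprMn !sqr_sqrtr//.
  by have := ler0n R k; rewrite -[k.+2%:R]natr1 -[k.+1%:R]natr1; lra.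
have Ve : (V * Num.sqrt k.+2%:R)^-1 = e k.+2 / V by rewrite invfM mulrC.
have NS : N k.+2 = (N k.+1 + x k.+1)%N by rewrite /N big_ord_recr.
rewrite big_ord_recr/= mulrDr lamS// Ve NS.
(* Without a purchase [V * lam] loses exactly what the sum gains, unless it is truncated to 0; then
   the correction term of the new round absorbs the gain. *)
case: ifPn => xk; last first.
  have lpos : 0 < lam k.+1.
    by rewrite lt_def lk andbT; apply: contra xk => /eqP /(x_lam0 km').
  move: IH; rewrite gt_eqF// addr0 addn0 => IH.
  set l := lam k.+1 + _; have lE : V * l = V * lam k.+1 - rho * e k.+2.
    by rewrite /l; field; rewrite gt_eqF.
  case: (ltgtP 0 l) => l0.
  - rewrite lE gt_eqF// addr0; lra.
  - rewrite eqxx mulr0; have := mulr_ge0 (ltW V0) lk; lra.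
  - rewrite ?eqxx mulr0; have := mulr_ge0 (ltW V0) lk; lra.
(* A purchase raises the left side by at most V e, with e the new step; the correction in the
   induction hypothesis may be lost as well, at a cost of at most 2 V e because consecutive steps
   differ by a factor at most 2. The total 3 V e, against e <= 2 (sqrt (N + 1) - sqrt N), is the
   origin of the coefficient 6. *)
set l := Num.max _ _.
have lle : V * l <= V * lam k.+1 + e k.+2 * (V - rho).
  have VV : V * (e k.+2 / V * (ct k.+1 - rho)) = e k.+2 * (ct k.+1 - rho).
    by field; rewrite gt_eqF.
  rewrite /l (maxr_pMr _ _ (ltW V0)) mulr0 mulrDr VV ge_max.
  have c1 : e k.+2 * (ct k.+1 - rho) <= e k.+2 * (V - rho).
    by rewrite ler_pM2l// lerB// ctV.
  have c2 : 0 <= e k.+2 * (V - rho) by rewrite mulr_ge0 ?subr_ge0// ltW.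
  by rewrite lerD2l c1/= addr_ge0// mulr_ge0// ltW.
(* Purchases never outnumber rounds, so the step of the current round is at most 1 / sqrt (N + 1),
   which telescopes in N. *)
have Ne : 2 * Num.sqrt (N k.+1)%:R + e k.+2 <= 2 * Num.sqrt (N k.+1 + true)%:R :> R.
  have Nk : (N k.+1 + true <= k.+2)%N by have := N_le k.+1; rewrite addn1.
  move: Nk; rewrite addn1; move: (N k.+1) => n nk.
  have sn : 0 < Num.sqrt (n.+1%:R : R) by rewrite sqrtr_gt0.
  apply: (@le_trans _ _ (2 * Num.sqrt n%:R + e n.+1)).
    by rewrite lerD2l /e lef_pV2 ?posrE// ler_sqrt ?ltr0n// ler_nat.
  rewrite -(ler_pM2r sn) mulrDl /e mulVf ?gt_eqF//.
  have := sqr_sqrtr (ler0n R n); have := sqr_sqrtr (ler0n R n.+1).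
  rewrite -[n.+1%:R]natr1; move: (Num.sqrt _) (Num.sqrt _) => a b ha hb.
  by have := sqr_ge0 (a - b); nra.
have E1 : e k.+2 * rho <= e k.+2 * V by rewrite ler_pM2l.
have E2 : rho * e k.+1 <= rho * (2 * e k.+2) by rewrite ler_pM2l.
have E3 : (if lam k.+1 == 0 then rho * e k.+1 else 0) <= rho * e k.+1.
  by case: ifP => // _; rewrite mulr_ge0 ?ltW// invr_gt0.
have E4 : 0 <= (if l == 0 then rho * e k.+2 else 0).
  by case: ifP => // _; rewrite mulr_ge0 ?ltW.
have E5 : 3 * V * (2 * Num.sqrt (N k.+1)%:R + e k.+2) <=
          3 * V * (2 * Num.sqrt (N k.+1 + true)%:R).
  by rewrite ler_pM2l// mulr_gt0.
move: IH lle E1 E2 E3 E4 E5.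
move: (\sum_(i < _) _) (Num.sqrt (N k.+1)%:R) (Num.sqrt (N k.+1 + true)%:R) (if lam _ == 0 then _ else _) (if l == 0 then _ else _) => S a b i1 i2.
move: (V * l) => Vl; move: (V * lam _) => Vlam; lra.
Qed.

(** The sum of the first k steps is at least sqrt k, and the correction is at most V <= V sqrt N
    because round 1 buys; hence 6 + 1 = 7. Squaring gives a number of purchases linear in k. *)
Lemma ogd_count k : (0 < k <= m)%N ->
  rho * Num.sqrt k%:R <= 7 * V * Num.sqrt (\sum_(j < k) x j)%:R.
Proof.
move=> km; have := count_invariant km; have lk := lam_ge0 km.
case: k km lk => // k km lk inv.
have N1 : 1 <= Num.sqrt (N k.+1)%:R :> R.
  by rewrite -{1}sqrtr1 ler_sqrt ?ler0n// ler1n /N big_ord_recl /= x0.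
have s1 : 0 < Num.sqrt (k.+1%:R : R) by rewrite sqrtr_gt0.
have ek : rho * e k.+1 <= V.
  apply: le_trans rhoV; rewrite -[leRHS]mulr1 ler_pM2l// /e invf_le1//.
  by rewrite -{1}sqrtr1 ler_sqrt ?ltr0n// ler1n.
have se : Num.sqrt k.+1%:R <= \sum_(j < k.+1) e j.+1.
  have -> : Num.sqrt k.+1%:R = \sum_(j < k.+1) e k.+1.
    rewrite sumr_const card_ord -[RHS]mulr_natl -[X in _ = X * _](sqr_sqrtr (ler0n _ _)).
    by rewrite expr2 mulfK ?gt_eqF.
  apply: ler_sum => j _; rewrite /e lef_pV2 ?posrE ?sqrtr_gt0 ?ltr0n//.
  by rewrite ler_sqrt ?ltr0n// ler_nat ltn_ord.
have E1 := mulr_ge0 (ltW V0) lk.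
have E2 : rho * Num.sqrt k.+1%:R <= rho * (\sum_(j < k.+1) e j.+1) by rewrite ler_pM2l.
have E3 : (if lam k.+1 == 0 then rho * e k.+1 else 0) <= V by case: ifP => // _; exact: ltW.
have E4 : V <= V * Num.sqrt (N k.+1)%:R by rewrite ler_peMr ?(ltW V0).
rewrite -/(N k.+1); lra.
Qed.

End OnlineGradientCount.

Lemma sum_inv_sqrt (R : realType) (n : nat) :
  \sum_(1 <= k < n) (Num.sqrt (k%:R : R))^-1 <= 2 * Num.sqrt n%:R.
Proof.
case: n => [|n]; first by rewrite big_geq// mulr_ge0 ?sqrtr_ge0.
apply: (@le_trans _ _ (2 * Num.sqrt n%:R)); last first.
  by rewrite ler_pM2l// ler_sqrt ?ltr0n// ler_nat.
elim: n => [|n IH]; first by rewrite big_geq// sqrtr0 mulr0.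
rewrite big_nat_recr//=; apply: le_trans (lerD IH (lexx _)) _.
have sn : 0 < Num.sqrt (n.+1%:R : R) by rewrite sqrtr_gt0 ltr0n.
rewrite -(ler_pM2r sn) mulrDl mulVf ?gt_eqF//.
have := sqr_sqrtr (ler0n R n); have := sqr_sqrtr (ler0n R n.+1).
rewrite -[n.+1%:R]natr1; move: (Num.sqrt _) (Num.sqrt _) => a b ha hb.
by have := sqr_ge0 (a - b); nra.
Qed.

(** The usual potential is the squared distance to the comparator u, and [a] freezes the multiplier
    after stopping. The gradient has no uniform bound: the bonus in c~ is not truncated and may be
    of order sqrt (L / k). Its squares, weighted by step sizes of order 1 / sqrt k, add a multiple
    of L / k^(3/2), whose sum converges, so only O(L) is lost. *)
Lemma ogd_regret (R : realType) (V L M c1 c2 u : R) (lam g : nat -> R)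
    (a : nat -> bool) (n : nat) :
  0 < V -> 0 <= L -> 0 <= c1 -> 0 <= c2 -> 0 <= u -> (0 < n)%N ->
  (forall k, (0 < k < n)%N -> lam k.+1 =
     if a k then Num.max (lam k + (V * Num.sqrt k.+1%:R)^-1 * g k) 0 else lam k) ->
  (forall k, (0 < k <= n)%N -> (lam k - u) ^+ 2 <= M) ->
  (forall k, (0 < k < n)%N -> a k -> g k ^+ 2 <= c1 + c2 * (L / k%:R)) ->
  \sum_(1 <= k < n) (a k)%:R * ((u - lam k) * g k) <=
    V / 2 * M * Num.sqrt n%:R + c1 / V * Num.sqrt n%:R + 3 * c2 * L / V.
Proof.
move=> V0 L0 c10 c20 u0 n0 lamS lamM gb.
suff: \sum_(1 <= k < n) (a k)%:R * ((u - lam k) * g k) <=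
    V / 2 * (M - (lam n - u) ^+ 2) * Num.sqrt n%:R + c1 / V * Num.sqrt n%:R +
    c2 * L / V * (3 - 2 / Num.sqrt n%:R).
  move=> h; apply: le_trans h _.
  have E1 : 0 <= V / 2 * (lam n - u) ^+ 2 * Num.sqrt n%:R.
    by rewrite mulr_ge0 ?sqrtr_ge0// mulr_ge0 ?sqr_ge0// divr_ge0// ltW.
  have E2 : 0 <= c2 * L / V * (2 / Num.sqrt n%:R).
    by rewrite !mulr_ge0 ?invr_ge0 ?sqrtr_ge0// ltW.
  lra.
elim: n n0 lamS lamM gb => [//|[|n] IH] _ lamS lamM gb.
  rewrite big_geq// sqrtr1 invr1.
  have E1 : 0 <= V / 2 * (M - (lam 1%N - u) ^+ 2) * 1.
    rewrite mulr1 mulr_ge0 ?subr_ge0 ?divr_ge0 ?(ltW V0)//.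
    exact: lamM.
  have E2 : 0 <= c1 / V by rewrite divr_ge0// ltW.
  have E3 : 0 <= c2 * L / V by rewrite !mulr_ge0 ?invr_ge0// ltW.
  lra.
rewrite big_nat_recr//=; apply: le_trans (lerD (IH _ _ _ _) (lexx _)) _ => //.
- by move=> k /andP[k0 kn]; apply: lamS; rewrite k0 ltnW.
- by move=> k /andP[k0 kn]; apply: lamM; rewrite k0 ltnW.
- by move=> k /andP[k0 kn]; apply: gb; rewrite k0 ltnW.
have nn : (0 < n.+1 < n.+2)%N by rewrite /= ltnSn.
have := lamS _ nn; have := gb _ nn.
have z1M : (lam n.+1 - u) ^+ 2 <= M by apply: lamM; rewrite /= leqnSn.
have z2M : (lam n.+2 - u) ^+ 2 <= M by apply: lamM.
have a0 : 0 < Num.sqrt (n.+1%:R : R) by rewrite sqrtr_gt0 ltr0n.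
have b0 : 0 < Num.sqrt (n.+2%:R : R) by rewrite sqrtr_gt0 ltr0n.
have aE := sqr_sqrtr (ler0n R n.+1); have bE := sqr_sqrtr (ler0n R n.+2).
have n1 : 1 <= n.+1%:R :> R by rewrite ler1n.
have bE' : Num.sqrt (n.+2%:R : R) ^+ 2 = n.+1%:R + 1 by rewrite bE natr1.
move: (Num.sqrt n.+1%:R) (Num.sqrt n.+2%:R) a0 b0 aE bE' n1 z1M z2M {bE}.
move: (n.+1%:R : R) (lam n.+1) (lam n.+2) (g n.+1) (a n.+1) => x l1 l2 y act.
move=> s t s0 t0 sE tE x1 z1M z2M yb l2E.
have st : s <= t by rewrite leNgt; apply/negP => ts; nra.
have ts : (t - s) * (t + s) = 1 by rewrite -subr_sqr; lra.
have c1t : c1 / (2 * V * t) <= c1 / V * (t - s).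
  rewrite ler_pdivrMr; last by rewrite !mulr_gt0.
  rewrite (_ : c1 / V * (t - s) * (2 * V * t) = c1 * ((t - s) * (2 * t))).
    by rewrite ler_peMr//; have := sqr_ge0 (t - s); lra.
  by field; rewrite gt_eqF.
have c2t : c2 * (L / x) / (2 * V * t) <= c2 * L / V * (2 / s - 2 / t).
  have -> : c2 * (L / x) / (2 * V * t) = c2 * L / V * ((2 * x * t)^-1).
    by field; rewrite !gt_eqF//; lra.
  apply: ler_wpM2l; first by rewrite !mulr_ge0 ?invr_ge0// ltW.
  have -> : 2 / s - 2 / t = 2 / (s * t * (t + s)).
    apply/eqP; rewrite eq_sym -(subr_eq0); apply/eqP.
    have -> : 2 / s - 2 / t = 2 * ((t - s) * (t + s)) / (s * t * (t + s)).
      by field; rewrite !gt_eqF// addr_gt0.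
    by rewrite ts mulr1 subrr.
  rewrite -[leLHS]div1r ler_pdivrMr; last by rewrite !mulr_gt0//; lra.
  rewrite mulrAC ler_pdivlMr; last by rewrite !mulr_gt0// addr_gt0.
  rewrite mul1r.
  have h : s * (t + s) <= 4 * x by nra.
  have := ler_wpM2l (ltW t0) h; lra.
case: act l2E yb => /= [l2E /(_ isT) yb|-> _]; last first.
  rewrite mul0r addr0.
  have E1 : 0 <= V / 2 * (M - (l1 - u) ^+ 2) * (t - s).
    by rewrite !mulr_ge0 ?subr_ge0// ltW.
  have E2 : 0 <= c1 / (2 * V * t) by rewrite divr_ge0 ?mulr_ge0// ltW.
  have E3 : 0 <= c2 * (L / x) / (2 * V * t).
    by rewrite !mulr_ge0 ?invr_ge0 ?mulr_ge0// ltW//; lra.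
  lra.
rewrite mul1r.
(* Truncation at 0 projects onto a half-line that contains u. *)
have step : (l2 - u) ^+ 2 <= (l1 + (V * t)^-1 * y - u) ^+ 2.
  rewrite l2E; move: (l1 + _) => w; case: (leP w 0) => w0.
    by rewrite ?max_r//; nra.
  by rewrite ?max_l// ltW.
have E0 : (u - l1) * y <= V * t / 2 * ((l1 - u) ^+ 2 - (l2 - u) ^+ 2) + y ^+ 2 / (2 * V * t).
  have Vt : 0 <= V * t / 2 by rewrite divr_ge0// mulr_ge0// ltW.
  have := ler_wpM2l Vt step.
  rewrite (_ : V * t / 2 * (l1 + (V * t)^-1 * y - u) ^+ 2 =
    V * t / 2 * (l1 - u) ^+ 2 - (u - l1) * y + y ^+ 2 / (2 * V * t)); first lra.
  by field; rewrite !gt_eqF.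
have E1 : 0 <= V / 2 * (M - (l1 - u) ^+ 2) * (t - s).
  by rewrite !mulr_ge0 ?subr_ge0// ltW.
have E2 : y ^+ 2 / (2 * V * t) <= (c1 + c2 * (L / x)) / (2 * V * t).
  by rewrite ler_pM2r// invr_gt0 !mulr_gt0.
lra.
Qed.

(** * The regret along one trajectory *)

Lemma reward_bound (R : realType) (x q : R) :
  0 <= x -> 0 <= q -> 0 <= reward x q <= x.
Proof.
move=> x0 q0; rewrite /reward /pos_part le_max lexx orbT/=.
by rewrite ge_max x0 andbT; lra.
Qed.

Lemma cost_bound (R : realType) (x q : R) :
  0 <= x -> 0 <= q -> 0 <= cost x q <= x.
Proof. by move=> x0 q0; rewrite /cost; case: ifP => [->|_]; rewrite ?q0 ?lexx. Qed.

Section Trajectory.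
Variables (R : realType) (V rho : R) (T : nat) (v p : nat -> R).

(** The state after k rounds is the state before round k + 1. All later functions of k inherit this
    shift: index k refers to round k + 1, with value [v k.+1], and index 0 is the forced first
    purchase. *)
Definition ogd_prefix (k : nat) : ogd_state R :=
  foldl (ogd_step V rho T v p) (OgdState 0 [::] (rho * T%:R) false 0) (iota 1 k).

Definition ogd_eps (obs : seq R) : R :=
  Num.sqrt ((ln 2 + 2 * ln T%:R) / (2 * (size obs)%:R)).

Definition ogd_rt (obs : seq R) (x : R) : R :=
  mean_over obs (reward x) + ogd_eps obs * x.

Definition ogd_ct (obs : seq R) (x : R) : R :=
  mean_over obs (cost x) - 2 * ogd_eps obs * x.

Definition ogd_bid (s : ogd_state R) (t : nat) (x : R) : bool :=
  (t == 1%N) || (st_lam s * ogd_ct (st_obs s) x <= ogd_rt (st_obs s) x).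

Definition ogd_active (k : nat) : bool := ~~ st_stopped (ogd_prefix k).

Definition ogd_buys (k : nat) : bool :=
  ogd_active k && ogd_bid (ogd_prefix k) k.+1 (v k.+1).

Lemma ogd_prefixS k :
  ogd_prefix k.+1 = ogd_step V rho T v p (ogd_prefix k) k.+1.
Proof.
by rewrite /ogd_prefix -[in iota 1 _](addn1 k) iotaD foldl_cat /= add1n.
Qed.

Lemma ogd_stepE s t : ~~ st_stopped s ->
  let x := ogd_bid s t (v t) in
  let B := st_budget s - (if x then cost (v t) (p t) else 0) in
  ogd_step V rho T v p s t = OgdState
    (if t == 1%N then st_lam s else
       Num.max (st_lam s + (V * Num.sqrt t%:R)^-1 *
         ((if x then ogd_ct (st_obs s) (v t) else 0) - rho)) 0)
    (if x then p t :: st_obs s else st_obs s) B (B < V)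
    (st_rev s + (if x then reward (v t) (p t) else 0)).
Proof.
move=> /negbTE ns /=; rewrite /ogd_step ns /ogd_bid.
by case: (t == 1%N).
Qed.

Lemma ogd_prefix_inactive k : ~~ ogd_active k -> ogd_prefix k.+1 = ogd_prefix k.
Proof. by rewrite negbK => sk; rewrite ogd_prefixS /ogd_step sk. Qed.

Lemma ogd_active_le j k : (j <= k)%N -> ogd_active k -> ogd_active j.
Proof.
move=> /subnKC <-; elim: (k - j)%N => [|i IH]; first by rewrite addn0.
rewrite addnS => a; apply: IH; apply: contraT => na.
by move: a; rewrite /ogd_active ogd_prefix_inactive// -/(ogd_active _) (negbTE na).
Qed.

Lemma ogd_buys0 : ogd_buys 0.
Proof. by []. Qed.

Lemma st_rev_prefix n : st_rev (ogd_prefix n) =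
  \sum_(k < n) (ogd_buys k)%:R * reward (v k.+1) (p k.+1).
Proof.
elim: n => [|n IH]; first by rewrite big_ord0.
rewrite big_ord_recr/= -IH; have [a|na] := boolP (ogd_active n); last first.
  by rewrite ogd_prefix_inactive// /ogd_buys (negbTE na) mul0r addr0.
rewrite ogd_prefixS ogd_stepE//= /ogd_buys a /=.
by case: ifP => _; rewrite ?mul1r ?mul0r.
Qed.

Lemma st_budget_prefix n : st_budget (ogd_prefix n) =
  rho * T%:R - \sum_(k < n) (ogd_buys k)%:R * cost (v k.+1) (p k.+1).
Proof.
elim: n => [|n IH]; first by rewrite big_ord0 subr0.
rewrite big_ord_recr/= opprD addrA -IH.
have [a|na] := boolP (ogd_active n); last first.
  by rewrite ogd_prefix_inactive// /ogd_buys (negbTE na) mul0r subr0.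
rewrite ogd_prefixS ogd_stepE//= /ogd_buys a /=.
by case: ifP => _; rewrite ?mul1r ?mul0r.
Qed.

(** Turns a sum over the random list of observed prices into a sum over rounds with 0/1 weights, the
    form to which the martingale bound applies. *)
Lemma sum_st_obs_prefix n (f : R -> R) :
  \sum_(q <- st_obs (ogd_prefix n)) f q = \sum_(k < n) (ogd_buys k)%:R * f (p k.+1).
Proof.
elim: n => [|n IH]; first by rewrite big_ord0 big_nil.
rewrite big_ord_recr/= -IH; have [a|na] := boolP (ogd_active n); last first.
  by rewrite ogd_prefix_inactive// /ogd_buys (negbTE na) mul0r addr0.
rewrite ogd_prefixS ogd_stepE//= /ogd_buys a /=.
by case: ifP => _; rewrite ?mul1r ?mul0r ?addr0// big_cons addrC.
Qed.

Lemma size_st_obs_prefix n :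
  size (st_obs (ogd_prefix n)) = (\sum_(k < n) ogd_buys k)%N.
Proof.
elim: n => [|n IH]; first by rewrite big_ord0.
rewrite big_ord_recr/= -IH; have [a|na] := boolP (ogd_active n); last first.
  by rewrite ogd_prefix_inactive// /ogd_buys (negbTE na) addn0.
rewrite ogd_prefixS ogd_stepE//= /ogd_buys a /=.
by case: ifP => _; rewrite ?addn0 ?addn1.
Qed.

Lemma st_lam_prefix1 : st_lam (ogd_prefix 1) = 0.
Proof. by rewrite ogd_prefixS ogd_stepE. Qed.

Lemma st_lam_prefixS k : (0 < k)%N -> st_lam (ogd_prefix k.+1) =
  if ogd_active k then
    Num.max (st_lam (ogd_prefix k) + (V * Num.sqrt k.+1%:R)^-1 *
      ((if ogd_buys k then ogd_ct (st_obs (ogd_prefix k)) (v k.+1) else 0) - rho)) 0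
  else st_lam (ogd_prefix k).
Proof.
case: k => // k _; have [a|na] := boolP (ogd_active k.+1); last first.
  by rewrite ogd_prefix_inactive.
by rewrite ogd_prefixS ogd_stepE//= /ogd_buys a.
Qed.

Lemma st_lam_prefix_ge0 k : 0 <= st_lam (ogd_prefix k).
Proof.
elim: k => [//|[_|k IH]]; first by rewrite st_lam_prefix1.
by rewrite st_lam_prefixS//; case: ifP => // _; rewrite le_max lexx orbT.
Qed.

Lemma st_stopped_prefix k : st_stopped (ogd_prefix k) -> st_budget (ogd_prefix k) < V.
Proof.
elim: k => [//|k IH]; have [a|na] := boolP (ogd_active k); last first.
  by rewrite ogd_prefix_inactive.
by rewrite ogd_prefixS ogd_stepE.
Qed.

End Trajectory.

(** Real variables replace the big sums so that [lra] can combine the estimates. [A] counts active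
    rounds and [A1] those after round 1; [G], [lG] and [l1] sum the estimated spending, its product
    with lambda, and lambda itself. [Yr], [Yc] and [Yk] sum mean reward, mean cost and actual cost
    over purchases; [AH] and [Ah] sum the dual function and the hinge at the actual values. [rv] is
    the revenue, [o] the gradient-ascent regret, and [x2] stands for V / rho. *)
Lemma regret_accounting (R : realFieldType) (V rho K Z Lam u om tT x2 x3
     A1 A G l1 lG Yc o Yk Yr Ah rv AH : R) :
  o <= x3 * Z ->
  om * A <= AH + rho * l1 ->
  Yr - rv <= 7 * V * Z ->
  Yk - Yc <= 7 * V * Z ->
  AH - Ah <= 7 * V * Z ->
  o = u * G - u * rho * A1 - lG + rho * l1 ->
  u * (Yc - V - 2 * K * Z) <= u * G ->
  u * rho * A1 <= u * rho * A ->
  u * (V + 2 * K * Z + 7 * V * Z) <= x2 * (V + 2 * K * Z + 7 * V * Z) ->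
  u * (Yk - Yc) <= u * (7 * V * Z) ->
  om * (tT - A) <= V * (tT - A) ->
  V <= 2 * (V * Z) ->
  x2 * V <= x2 * (2 * (V * Z)) ->
  V * (tT - A) - x2 * V <= u * (Yk - rho * A) ->
  Ah + lG - V - 2 * (2 + Lam) * K * Z <= Yr ->
  tT * om - rv <=
  (16 * V + 2 * (2 + Lam) * K + x3 + x2 * (11 * V + 2 * K)) * Z.
Proof. by intros; lra. Qed.

(** * Deterministic control of the multiplier, the purchases and the bonus *)

Section Regret.
Variables (R : realType) (V rho : R) (T : nat) (v p : nat -> R).
Hypotheses (V0 : 0 < V) (rho0 : 0 < rho) (rhoV : rho <= V) (T2 : (1 < T)%N).
Hypothesis vb : forall t, 0 <= v t <= V.
Hypothesis pb : forall t, 0 <= p t <= V.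

Local Ltac lra_params := have := V0; have := rho0; have := rhoV; lra.

Let L : R := ln T%:R.
Let S := ogd_prefix V rho T v p.
Let lam k := st_lam (S k).
Let act := ogd_active V rho T v p.
Let y := ogd_buys V rho T v p.
Let eps k := ogd_eps T (st_obs (S k)).
Let rt k := ogd_rt T (st_obs (S k)) (v k.+1).
Let ct k := ogd_ct T (st_obs (S k)) (v k.+1).
Let N k : R := (size (st_obs (S k)))%:R.
Let kap : R := (rho / (7 * V)) ^+ 2.
Let Lam : R := 3 * V / (2 * rho) + 1.

Let mean_bound k f b : (forall j, 0 <= f (p j) <= b) ->
  0 <= mean_over (st_obs (S k)) f <= b.
Proof.
move=> fb; rewrite /mean_over sum_st_obs_prefix size_st_obs_prefix natr_sum -/y.
have b0 : 0 <= b by have /andP[h1 h2] := fb 0%N; exact: le_trans h1 h2.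
set M := \sum_(i < k) (y i)%:R.
have M0 : 0 <= M by apply: sumr_ge0.
have h1 : 0 <= \sum_(i < k) (y i)%:R * f (p i.+1).
  by apply: sumr_ge0 => i _; rewrite mulr_ge0//; case/andP: (fb i.+1).
have h2 : \sum_(i < k) (y i)%:R * f (p i.+1) <= b * M.
  rewrite mulr_sumr; apply: ler_sum => i _; rewrite mulrC ler_wpM2r//.
  by case/andP: (fb i.+1).
(* With no observation [mean_over] is 0 / 0 = 0, which still lies in the range. *)
rewrite divr_ge0//=; have [->|Mn] := eqVneq M 0; first by rewrite invr0 mulr0.
by rewrite ler_pdivrMr// lt_def Mn.
Qed.

Let eps_ge0 k : 0 <= eps k. Proof. exact: sqrtr_ge0. Qed.

Let v0 k : 0 <= v k. Proof. by case/andP: (vb k). Qed.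
Let vV k : v k <= V. Proof. by case/andP: (vb k). Qed.

Let mean_reward k : 0 <= mean_over (st_obs (S k)) (reward (v k.+1)) <= v k.+1.
Proof. by apply: mean_bound => j; apply: reward_bound => //; case/andP: (pb j). Qed.

Let mean_cost k : 0 <= mean_over (st_obs (S k)) (cost (v k.+1)) <= v k.+1.
Proof. by apply: mean_bound => j; apply: cost_bound => //; case/andP: (pb j). Qed.

Let ct_le k : ct k <= v k.+1 - 2 * eps k * v k.+1.
Proof. by rewrite /ct /ogd_ct; have := mean_cost k; rewrite /eps; lra_params. Qed.

Let ct_leV k : ct k <= V.
Proof.
have := ct_le k; have := vV k.+1; have := mulr_ge0 (eps_ge0 k) (v0 k.+1); lra_params.
Qed.

Let ct_norm k : `|ct k| <= V * (1 + 2 * eps k).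
Proof.
have e1 : eps k * v k.+1 <= eps k * V by rewrite ler_wpM2l.
have := ct_leV k; have := mulr_ge0 (eps_ge0 k) (ltW V0).
have : - (2 * eps k * v k.+1) <= ct k.
  by rewrite /ct /ogd_ct -/(eps k) lerDr; case/andP: (mean_cost k).
move=> h1 h2 h3; have h4 : - (V * (1 + 2 * eps k)) <= ct k by lra_params.
by rewrite ler_norml h4; lra_params.
Qed.

Let rt_ge0 k : 0 <= rt k.
Proof.
apply: addr_ge0; first by case/andP: (mean_reward k).
exact: mulr_ge0 (eps_ge0 k) (v0 k.+1).
Qed.

Let rt_le k : rt k <= v k.+1 + eps k * v k.+1.
Proof. by rewrite /rt /ogd_rt lerD2r; case/andP: (mean_reward k). Qed.

Let y_act k : y k -> act k. Proof. by case/andP. Qed.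

Let y_rule k : (0 < k)%N -> act k -> y k = (lam k * ct k <= rt k).
Proof. by case: k => // k _ a; rewrite /y /ogd_buys -/(act _) a. Qed.

Let lam_ge0 k : 0 <= lam k. Proof. exact: st_lam_prefix_ge0. Qed.

(* lambda increases only if c~ > rho > 0, which forces eps < 1/2; the purchase rule then
   gives lambda * rho <= lambda * c~ <= r~ <= 3 V / 2. *)
Let lam_le k : lam k <= Lam.
Proof.
have Lam1 : 1 <= Lam by rewrite lerDr divr_ge0// ?mulr_ge0// ltW.
elim: k => [|[_|k IH]]; first exact: le_trans ler01 Lam1.
  by rewrite /lam /S st_lam_prefix1 (le_trans ler01).
rewrite /lam /S st_lam_prefixS//; case: ifP => // a.
have s1 : 1 <= Num.sqrt (k.+2%:R : R) by rewrite -{1}sqrtr1 ler_sqrt ?ltr0n// ler1n.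
have Vs : 0 < V * Num.sqrt k.+2%:R by rewrite mulr_gt0// (lt_le_trans ltr01).
have eta0 : 0 < (V * Num.sqrt k.+2%:R)^-1 by rewrite invr_gt0.
rewrite ge_max (le_trans ler01 Lam1) andbT -/S -/(lam _) -/(ct _) -/(y _).
have dec g : g <= 0 -> lam k.+1 + (V * Num.sqrt k.+2%:R)^-1 * g <= Lam.
  by move=> g0; have := mulr_ge0_le0 (ltW eta0) g0; have := IH; rewrite -/lam /lam; lra_params.
case: ifP => [yk|_]; last by apply: dec; lra_params.
have [crho|crho] := leP (ct k.+1) rho; first by apply: dec; lra_params.
have := y_rule (ltn0Sn k) a; rewrite yk => /esym rule.
have h1 := ct_le k.+1; have h2 := rt_le k.+1.
have w0 := v0 k.+2; have wV := vV k.+2; have e0 := eps_ge0 k.+1.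
have e2 : eps k.+1 * v k.+2 <= v k.+2 / 2 by lra_params.
have lr : lam k.+1 * rho <= lam k.+1 * ct k.+1 by rewrite ler_wpM2l// ltW.
have l1 : lam k.+1 <= 3 * V / (2 * rho).
  rewrite ler_pdivlMr ?mulr_gt0//; lra_params.
have g1 : (V * Num.sqrt k.+2%:R)^-1 * (ct k.+1 - rho) <= 1.
  rewrite mulrC ler_pdivrMr// mul1r.
  apply: (@le_trans _ _ (V * 1)); last by rewrite ler_pM2l.
  by have := ct_leV k.+1; lra_params.
by rewrite /Lam lerD.
Qed.

Let kap_gt0 : 0 < kap. Proof. by rewrite exprn_gt0// divr_gt0// mulr_gt0. Qed.
Let kap_le1 : kap <= 1.
Proof.
rewrite /kap expr_le1// ?divr_ge0 ?mulr_ge0 ?(ltW V0) ?(ltW rho0)//.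
by rewrite ler_pdivrMr ?mulr_gt0//; lra_params.
Qed.

Let N_ge k : (0 < k)%N -> act k -> kap * k%:R <= N k.
Proof.
move=> k0 a.
have actj j : (j <= k)%N -> act j by move=> jk; exact: ogd_active_le jk a.
have kk : (0 < k <= k)%N by rewrite k0 leqnn.
have h : rho * Num.sqrt k%:R <= 7 * V * Num.sqrt (\sum_(j < k) y j)%:R.
  apply: (@ogd_count _ V rho k lam ct y V0 rho0 rhoV (ogd_buys0 _ _ _ _ _)
    (st_lam_prefix1 _ _ _ _ _)) => //.
  - move=> j /andP[j0 jk]; rewrite /lam /S st_lam_prefixS//.
    by have -> : ogd_active V rho T v p j by exact: actj (ltnW jk).
  - move=> j /andP[j0 jk] lj; rewrite y_rule ?actj ?(ltnW jk)//.
    by rewrite lj mul0r rt_ge0.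
rewrite /N size_st_obs_prefix -/y.
have V7 : 0 < 7 * V by rewrite mulr_gt0.
have : (rho * Num.sqrt k%:R) ^+ 2 <= (7 * V * Num.sqrt (\sum_(j < k) y j)%:R) ^+ 2.
  rewrite ler_sqr ?nnegrE//; apply: mulr_ge0; rewrite ?sqrtr_ge0//; exact: ltW.
rewrite !exprMn !sqr_sqrtr ?ler0n// => {}h.
rewrite /kap expr_div_n mulrAC ler_pdivrMr ?exprn_gt0//.
by move: h; rewrite exprMn; lra_params.
Qed.

Let ln2_ge : 1 / 2 <= ln 2 :> R.
Proof.
have := @le_ln1Dx R (- 2^-1); rewrite (_ : 1 + - 2^-1 = 2^-1); last by field.
by rewrite lnV ?posrE// => /(_ _); rewrite ltrN2 invf_lt1 ?ltr1n// => /(_ isT); lra_params.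
Qed.

Let L_ge_ln2 : ln 2 <= L.
Proof. by rewrite /L ler_ln ?posrE ?ltr0n ?ler_nat// ltnW. Qed.

(** With ln 2 <= L and at least kap k observations, eps^2 is at most 3 L / (2 kap k); kap <= 1
    allows rounding this up to (2 / kap)^2 L / k. *)
Let eps_le k : (0 < k)%N -> act k -> eps k <= 2 / kap * Num.sqrt (L / k%:R).
Proof.
move=> k0 a; have kR : 0 < k%:R :> R by rewrite ltr0n.
have Nk := N_ge k0 a; have kk : 0 < kap * k%:R by rewrite mulr_gt0.
have N0 : 0 < N k by exact: lt_le_trans Nk.
have L0 : 0 < L by have := ln2_ge; have := L_ge_ln2; lra_params.
have kap2 : 0 <= 2 / kap by rewrite divr_ge0// ltW.
apply: (@le_trans _ _ (Num.sqrt ((2 / kap) ^+ 2 * (L / k%:R)))); last first.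
  by rewrite sqrtrM ?sqr_ge0// sqrtr_sqr ger0_norm.
rewrite /eps /ogd_eps -/(N k) ler_sqrt; last first.
  by rewrite mulr_ge0 ?sqr_ge0// divr_ge0// ltW.
rewrite ler_pdivrMr ?mulr_gt0//.
have h1 : (2 / kap) ^+ 2 * (L / k%:R) * (2 * (kap * k%:R)) <=
    (2 / kap) ^+ 2 * (L / k%:R) * (2 * N k).
  rewrite ler_wpM2l//; first by rewrite mulr_ge0 ?sqr_ge0// divr_ge0// ltW.
  by rewrite ler_pM2l.
apply: le_trans h1.
have -> : (2 / kap) ^+ 2 * (L / k%:R) * (2 * (kap * k%:R)) = 8 * L / kap.
  by field; rewrite !gt_eqF.
rewrite ler_pdivlMr//; have := L_ge_ln2.
have : (ln 2 + 2 * L) * kap <= (ln 2 + 2 * L) * 1 by rewrite ler_wpM2l//; have := ln2_ge; lra_params.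
rewrite -/L; lra_params.
Qed.

(** * Regret from deviation bounds on mean reward, mean cost and dual function *)

Variables (r c H : R -> R) (om : R).
Hypothesis rb : forall x, 0 <= r x <= V.
Hypothesis cb : forall x, 0 <= c x <= V.
Hypothesis om_dual : forall l, 0 <= l -> om <= H l + l * rho.
Hypothesis omV : om <= V.

Let hinge (l x : R) : R := Num.max (r x - l * c x) 0.
Let Z : R := Num.sqrt (T%:R * L).
Let delta (k : nat) : R := Num.sqrt (L / k%:R).

Hypothesis reward_dev :
  \sum_(k < T) (y k)%:R * (r (v k.+1) - reward (v k.+1) (p k.+1)) <= 7 * V * Z.
Hypothesis cost_dev :
  \sum_(k < T) (y k)%:R * (cost (v k.+1) (p k.+1) - c (v k.+1)) <= 7 * V * Z.
Hypothesis hinge_dev :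
  \sum_(k < T) (act k)%:R * (H (lam k) - hinge (lam k) (v k.+1)) <= 7 * V * Z.
Hypothesis reward_est : forall k, (0 < k < T)%N ->
  `|\sum_(j < k) (y j)%:R * (reward (v k.+1) (p j.+1) - r (v k.+1))| <=
  7 * V * Num.sqrt (k%:R * L).
Hypothesis cost_est : forall k, (0 < k < T)%N ->
  `|\sum_(j < k) (y j)%:R * (cost (v k.+1) (p j.+1) - c (v k.+1))| <=
  7 * V * Num.sqrt (k%:R * L).

(** The 11 is 7 from the error of the empirical mean plus 4 from the larger of the two bonuses, 2
    eps v. *)
Let K : R := 11 * V / kap.

Let L_gt0 : 0 < L.
Proof. by have := ln2_ge; have := L_ge_ln2; lra_params. Qed.

(** The deviation of the unnormalised sum is of order sqrt (k L); dividing by at least kap k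
    observations leaves delta / kap. *)
Let mean_err k f (x : R) : (0 < k)%N -> act k ->
  `|\sum_(j < k) (y j)%:R * (f (p j.+1) - x)| <= 7 * V * Num.sqrt (k%:R * L) ->
  `|mean_over (st_obs (S k)) f - x| <= 7 * V / kap * delta k.
Proof.
move=> k0 a h; have kR : 0 < k%:R :> R by rewrite ltr0n.
have kk : 0 < kap * k%:R by rewrite mulr_gt0.
have Nk := N_ge k0 a; have N0 : 0 < N k by exact: lt_le_trans Nk.
have -> : mean_over (st_obs (S k)) f - x =
    (\sum_(j < k) (y j)%:R * (f (p j.+1) - x)) / N k.
  rewrite /mean_over sum_st_obs_prefix -/y -/(N k).
  under [in RHS]eq_bigr do rewrite mulrBr.
  rewrite sumrB mulrBl -mulr_suml -natr_sum -size_st_obs_prefix -/S -/(N k).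
  by congr (_ - _); rewrite mulrC mulrA mulVf ?mul1r ?gt_eqF.
rewrite normrM normfV (ger0_norm (ltW N0)) ler_pdivrMr//.
apply: le_trans h _.
have -> : Num.sqrt (k%:R * L) = k%:R * delta k.
  rewrite /delta -[X in X * Num.sqrt _](ger0_norm (ltW kR)) -sqrtr_sqr -sqrtrM ?sqr_ge0//.
  by congr Num.sqrt; field; rewrite gt_eqF.
have -> : 7 * V * (k%:R * delta k) = 7 * V / kap * delta k * (kap * k%:R).
  by field; rewrite gt_eqF.
apply: ler_wpM2l => //; apply: mulr_ge0; last exact: sqrtr_ge0.
by apply: divr_ge0; [apply: mulr_ge0 => //|]; exact: ltW.
Qed.

Let epsv_le k : (0 < k)%N -> act k -> eps k * v k.+1 <= 2 * V / kap * delta k.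
Proof.
move=> k0 a; rewrite (_ : 2 * V / kap * delta k = 2 / kap * delta k * V); last ring.
by apply: ler_pM => //; exact: eps_le.
Qed.

Let delta_ge0 k : 0 <= delta k. Proof. exact: sqrtr_ge0. Qed.
Let Vkd_ge0 k : 0 <= V / kap * delta k.
Proof. by rewrite mulr_ge0 ?divr_ge0 ?(ltW V0) ?(ltW kap_gt0). Qed.

Let rt_err k : (0 < k < T)%N -> act k -> `|rt k - r (v k.+1)| <= K * delta k.
Proof.
move=> kT a; have /andP[k0 _] := kT.
have := mean_err k0 a (reward_est kT); rewrite !ler_norml => /andP[h1 h2].
have h3 := epsv_le k0 a; have h4 := mulr_ge0 (eps_ge0 k) (v0 k.+1).
have h5 := Vkd_ge0 k; rewrite /rt /ogd_rt -/(eps k) /K.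
by apply/andP; split; lra_params.
Qed.

Let ct_err k : (0 < k < T)%N -> act k -> `|ct k - c (v k.+1)| <= K * delta k.
Proof.
move=> kT a; have /andP[k0 _] := kT.
have := mean_err k0 a (cost_est kT); rewrite !ler_norml => /andP[h1 h2].
have h3 := epsv_le k0 a; have h4 := mulr_ge0 (eps_ge0 k) (v0 k.+1).
have h5 := Vkd_ge0 k; rewrite /ct /ogd_ct -/(eps k) /K.
by apply/andP; split; lra_params.
Qed.

Let spend k : R := if y k then ct k else 0.

(** If the buyer buys, either the hinge is r - lambda c and only the error of c~ remains, or it is 0
    and the rule gives lambda c~ <= r~, close to r. If the buyer declines, r~ < lambda c~ forces the
    hinge below (1 + lambda) times the estimation error. *)
Let round_ineq k : (0 < k < T)%N ->
  (act k)%:R * (hinge (lam k) (v k.+1) + lam k * spend k) - (2 + Lam) * K * delta k <=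
  (y k)%:R * r (v k.+1).
Proof.
move=> kT; have /andP[k0 _] := kT.
have Kd : 0 <= K * delta k.
  apply: mulr_ge0 => //; apply: divr_ge0; last exact: ltW.
  by apply: mulr_ge0 => //; exact: ltW.
have l0 := lam_ge0 k; have ll := lam_le k.
have lK : lam k * (K * delta k) <= Lam * (K * delta k) by rewrite ler_wpM2r.
have lK0 := mulr_ge0 l0 Kd.
have [a|na] := boolP (act k); last first.
  rewrite /y /ogd_buys -/(act k) (negbTE na) !mul0r; lra_params.
have := ct_err kT a; have := rt_err kT a; rewrite !ler_norml => /andP[r1 r2] /andP[c1 c2].
have e1 : lam k * ct k <= lam k * c (v k.+1) + lam k * (K * delta k).
  by rewrite -mulrDr ler_wpM2l//; lra_params.
have e2 : lam k * c (v k.+1) - lam k * (K * delta k) <= lam k * ct k.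
  by rewrite -mulrBr ler_wpM2l//; lra_params.
rewrite /hinge /spend mul1r (y_rule k0 a).
have [rule|rule] := leP (lam k * ct k) (rt k); rewrite ?mul1r ?mul0r ?mulr0;
  case: (leP (r (v k.+1) - lam k * c (v k.+1)) 0) => hi; rewrite ?max_l ?max_r//; lra_params.
Qed.

Let g k := spend k - rho.

(** Here |g| <= 2 V (1 + eps), and (1 + eps)^2 <= 2 (1 + eps^2) separates the constant part from the
    part of order L / k. *)
Let g_sqr k : (0 < k)%N -> act k ->
  g k ^+ 2 <= 8 * V ^+ 2 + 32 * V ^+ 2 / kap ^+ 2 * (L / k%:R).
Proof.
move=> k0 a; have e0 := eps_ge0 k; have ek := eps_le k0 a.
have kR : 0 < k%:R :> R by rewrite ltr0n.
have gn : `|g k| <= 2 * V * (1 + eps k).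
  have := ct_norm k; have := mulr_ge0 (eps_ge0 k) (ltW V0).
  rewrite /g /spend !ler_norml => Ve /andP[c1 c2].
  by case: ifP => _; apply/andP; split; lra_params.
have e2 : eps k ^+ 2 <= 4 / kap ^+ 2 * (L / k%:R).
  have : eps k ^+ 2 <= (2 / kap * delta k) ^+ 2.
    by rewrite ler_sqr ?nnegrE//; exact: le_trans e0 ek.
  have Lk : 0 <= L / k%:R by apply: divr_ge0; exact: ltW.
  rewrite exprMn [delta k ^+ 2](sqr_sqrtr Lk).
  by rewrite expr_div_n (_ : 2 ^+ 2 = 4 :> R)//; ring.
have : g k ^+ 2 <= (2 * V * (1 + eps k)) ^+ 2.
  rewrite -[leLHS]real_normK ?num_real// ler_sqr ?nnegrE//; exact: le_trans (normr_ge0 _) gn.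
move=> h; apply: le_trans h _.
have V2 : 0 < V ^+ 2 by rewrite exprn_gt0.
have h1 : V ^+ 2 * eps k ^+ 2 <= V ^+ 2 * (4 / kap ^+ 2 * (L / k%:R)) by rewrite ler_pM2l.
have h2 := mulr_ge0 (ltW V2) (sqr_ge0 (1 - eps k)).
rewrite (_ : (2 * V * (1 + eps k)) ^+ 2 = 8 * V ^+ 2 + 8 * (V ^+ 2 * eps k ^+ 2) -
  4 * (V ^+ 2 * (1 - eps k) ^+ 2)); last ring.
rewrite (_ : 32 * V ^+ 2 / kap ^+ 2 * (L / k%:R) =
  8 * (V ^+ 2 * (4 / kap ^+ 2 * (L / k%:R)))); last ring.
lra_params.
Qed.

Let T0 : 0 < T%:R :> R. Proof. by rewrite ltr0n ltnW. Qed.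

Let sum_delta : \sum_(1 <= k < T) delta k <= 2 * Z.
Proof.
have -> : \sum_(1 <= k < T) delta k =
    Num.sqrt L * \sum_(1 <= k < T) (Num.sqrt (k%:R : R))^-1.
  rewrite mulr_sumr; apply: eq_big_nat => k /andP[k0 _].
  by rewrite /delta sqrtrM ?(ltW L_gt0)// sqrtrV.
rewrite /Z sqrtrM ?(ltW T0)// [leRHS](_ : _ = Num.sqrt L * (2 * Num.sqrt T%:R)); last ring.
by rewrite ler_wpM2l ?sqrtr_ge0// sum_inv_sqrt.
Qed.

Let sqrtT_le : Num.sqrt T%:R <= 2 * Z.
Proof.
have L4 : 1 / 4 <= L by have := ln2_ge; have := L_ge_ln2; lra_params.
rewrite /Z sqrtrM ?(ltW T0)//.
have : 1 / 2 <= Num.sqrt L.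
  by rewrite -(ler_sqr (_ : _ \in Num.nneg)) ?nnegrE ?sqrtr_ge0// sqr_sqrtr ?(ltW L_gt0)//; lra_params.
move=> /(ler_wpM2l (sqrtr_ge0 T%:R)); lra_params.
Qed.

Let one_le : 1 <= 2 * Z.
Proof.
apply: le_trans sqrtT_le; rewrite -{1}sqrtr1 ler_sqrt//.
by rewrite ler1n ltnW.
Qed.

Let L_le : L <= Z.
Proof.
have -> : L = Num.sqrt (L * L) by rewrite -expr2 sqrtr_sqr ger0_norm// ltW.
have TL : 0 <= T%:R * L by apply: mulr_ge0; exact: ltW.
rewrite ler_sqrt// ler_pM2r//; apply: ltW; exact: ln_sublinear.
Qed.

Let hinge_bound k : 0 <= hinge (lam k) (v k.+1) <= V.
Proof.
rewrite /hinge le_max lexx orbT ge_max (ltW V0) andbT /=.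
have /andP[c0 _] := cb (v k.+1); have /andP[_ rV] := rb (v k.+1).
have := mulr_ge0 (lam_ge0 k) c0; lra_params.
Qed.

(** Round 1 buys without any estimate, so inequalities that involve estimates start at index 1 and
    the first round is charged at most V. *)
Let sum_recl (F : nat -> R) : \sum_(k < T) F k = F 0%N + \sum_(1 <= k < T) F k.
Proof. by rewrite -(big_mkord xpredT F) big_ltn// ltnW. Qed.

Let purchases_ge :
  \sum_(k < T) (act k)%:R * hinge (lam k) (v k.+1) +
    \sum_(1 <= k < T) (act k)%:R * (lam k * spend k) - V - 2 * (2 + Lam) * K * Z <=
  \sum_(k < T) (y k)%:R * r (v k.+1).
Proof.
rewrite (sum_recl (fun k => (act k)%:R * hinge (lam k) (v k.+1))).
rewrite (sum_recl (fun k => (y k)%:R * r (v k.+1))).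
have h0 : hinge (lam 0) (v 1%N) <= V by case/andP: (hinge_bound 0).
have y0 : 0 <= r (v 1%N) by case/andP: (rb (v 1%N)).
have K0 : 0 <= (2 + Lam) * K.
  apply: mulr_ge0; first by have := lam_ge0 0; have := lam_le 0; lra_params.
  by apply: divr_ge0; [apply: mulr_ge0 => //|]; exact: ltW.
have := ler_wpM2l K0 sum_delta.
have : \sum_(1 <= k < T) ((act k)%:R * (hinge (lam k) (v k.+1) + lam k * spend k) -
    (2 + Lam) * K * delta k) <= \sum_(1 <= k < T) (y k)%:R * r (v k.+1).
  by rewrite big_nat [leRHS]big_nat; apply: ler_sum => k kT; exact: round_ineq.
rewrite sumrB -mulr_sumr; under eq_bigr do rewrite mulrDr; rewrite big_split /=.
lra_params.
Qed.

Let spend_ge : \sum_(k < T) (y k)%:R * c (v k.+1) - V - 2 * K * Z <=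
  \sum_(1 <= k < T) (act k)%:R * spend k.
Proof.
rewrite (sum_recl (fun k => (y k)%:R * c (v k.+1))).
have K0 : 0 <= K by apply: divr_ge0; [apply: mulr_ge0 => //|]; exact: ltW.
have c0 : c (v 1%N) <= V by case/andP: (cb (v 1%N)).
have := ler_wpM2l K0 sum_delta.
have : \sum_(1 <= k < T) ((y k)%:R * c (v k.+1) - K * delta k) <=
    \sum_(1 <= k < T) (act k)%:R * spend k.
  rewrite big_nat [leRHS]big_nat; apply: ler_sum => k kT.
  have Kd := mulr_ge0 K0 (delta_ge0 k); rewrite /spend.
  have [yk|nyk] := boolP (y k); last by rewrite mul0r mulr0; lra_params.
  have a := y_act yk; rewrite a !mul1r.
  by have := ct_err kT a; rewrite ler_norml => /andP[h1 h2]; lra_params.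
rewrite sumrB -mulr_sumr /=; lra_params.
Qed.

Let u : R := if st_stopped (S T) then V / rho else 0.

Let u_bound : 0 <= u <= V / rho.
Proof.
have : 0 <= V / rho by apply: divr_ge0; exact: ltW.
by rewrite /u; case: ifP => _ h; rewrite h lexx.
Qed.

Let rounds_le : \sum_(k < T) (act k)%:R <= T%:R :> R.
Proof.
rewrite -[leRHS](_ : \sum_(k < T) 1 = _); last by rewrite sumr_const card_ord.
by apply: ler_sum => k _; rewrite lern1 leq_b1.
Qed.

(** Stopping means that more than rho T - V has been spent; multiplying by u = V / rho pays V for
    each inactive round, up to V^2 / rho. If the buyer never stops, all T rounds are active and the
    left side is not positive. *)
Let budget_bound :
  V * (T%:R - \sum_(k < T) (act k)%:R) - V ^+ 2 / rho <=
  u * (\sum_(k < T) (y k)%:R * cost (v k.+1) (p k.+1) - rho * \sum_(k < T) (act k)%:R).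
Proof.
have V2 : 0 <= V ^+ 2 / rho by apply: divr_ge0; [exact: sqr_ge0|exact: ltW].
rewrite /u; case: ifP => st.
  have := st_stopped_prefix st; rewrite st_budget_prefix -/y => B.
  set A := \sum_(k < T) (act k)%:R; set Y := \sum_(k < T) _ in B *.
  have -> : V * (T%:R - A) - V ^+ 2 / rho = V / rho * (rho * T%:R - V - rho * A).
    by field; rewrite gt_eqF.
  apply: ler_wpM2l; first by apply: divr_ge0; exact: ltW.
  lra_params.
have -> : \sum_(k < T) (act k)%:R = T%:R :> R.
  rewrite -[RHS](_ : \sum_(k < T) 1 = _); last by rewrite sumr_const card_ord.
  apply: eq_bigr => k _; suff -> : act k by [].
  by apply: (@ogd_active_le _ _ _ _ _ _ k T); [exact: ltnW|rewrite /ogd_active -/S st].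
rewrite mul0r subrr mulr0; lra_params.
Qed.

(** 16 V is 7 V each for the reward and hinge deviations and 2 V for the first round, additive
    constants being absorbed by 1 <= 2 Z. The bracket is the gradient-ascent regret, using sqrt T <=
    2 Z and L <= Z. In the last term, u <= V / rho multiplies the cost deviation 7 V and two
    boundary losses of 2 V, one from round 1 and one from the leftover budget. *)
Definition regret_const : R :=
  16 * V + 2 * (2 + Lam) * K + (V * (Lam + V / rho) ^+ 2 + 16 * V + 96 * V / kap ^+ 2) +
  V / rho * (11 * V + 2 * K).

Lemma ogd_regret_bound :
  T%:R * om - st_rev (S T) <= regret_const * Z.
Proof.
have /andP[u0 uV] := u_bound; have Vr := ltW V0.
have Z0 : 0 <= Z by exact: sqrtr_ge0.
have K0 : 0 <= K by apply: divr_ge0; [apply: mulr_ge0 => //|]; exact: ltW.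
have ogd : \sum_(1 <= k < T) (act k)%:R * ((u - lam k) * g k) <=
    V / 2 * (Lam + V / rho) ^+ 2 * Num.sqrt T%:R +
    8 * V ^+ 2 / V * Num.sqrt T%:R + 3 * (32 * V ^+ 2 / kap ^+ 2) * L / V.
  apply: ogd_regret => //.
  - exact: ltW.
  - by apply: mulr_ge0 => //; exact: sqr_ge0.
  - by apply: divr_ge0; [apply: mulr_ge0 => //|]; exact: sqr_ge0.
  - exact: ltnW.
  - by move=> k /andP[k0 _]; rewrite /lam /S st_lam_prefixS.
  - move=> k _; have := lam_ge0 k; have := lam_le k => l1 l2.
    rewrite -[leLHS]real_normK ?num_real// ler_sqr ?nnegrE//; last lra_params.
    by rewrite ler_norml; apply/andP; split; lra_params.
  - by move=> k /andP[k0 _]; exact: g_sqr.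
have ogdZ : V / 2 * (Lam + V / rho) ^+ 2 * Num.sqrt T%:R +
    8 * V ^+ 2 / V * Num.sqrt T%:R + 3 * (32 * V ^+ 2 / kap ^+ 2) * L / V <=
    (V * (Lam + V / rho) ^+ 2 + 16 * V + 96 * V / kap ^+ 2) * Z.
  have -> : 8 * V ^+ 2 / V = 8 * V by field; rewrite gt_eqF.
  have -> : 3 * (32 * V ^+ 2 / kap ^+ 2) * L / V = 96 * V / kap ^+ 2 * L.
    by field; rewrite !gt_eqF.
  have c1 : 0 <= V / 2 * (Lam + V / rho) ^+ 2.
    by apply: mulr_ge0; [apply: divr_ge0 => //|exact: sqr_ge0].
  have c2 : 0 <= 8 * V by apply: mulr_ge0.
  have c3 : 0 <= 96 * V / kap ^+ 2.
    by apply: divr_ge0; [apply: mulr_ge0 => //|exact: sqr_ge0].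
  have := ler_wpM2l c1 sqrtT_le; have := ler_wpM2l c2 sqrtT_le; have := ler_wpM2l c3 L_le.
  lra_params.
have dual : om * \sum_(k < T) (act k)%:R <=
    \sum_(k < T) (act k)%:R * H (lam k) + rho * \sum_(k < T) (act k)%:R * lam k.
  rewrite !mulr_sumr -big_split/=; apply: ler_sum => k _.
  have := ler_wpM2l (ler0n R (act k)) (om_dual (lam_ge0 k)); lra_params.
have rew : \sum_(k < T) (y k)%:R * r (v k.+1) - st_rev (S T) <= 7 * V * Z.
  apply: le_trans reward_dev; rewrite st_rev_prefix -sumrB ler_sum// => k _.
  by rewrite mulrBr.
have cst : \sum_(k < T) (y k)%:R * cost (v k.+1) (p k.+1) -
    \sum_(k < T) (y k)%:R * c (v k.+1) <= 7 * V * Z.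
  by apply: le_trans cost_dev; rewrite -sumrB ler_sum// => k _; rewrite mulrBr.
have hin : \sum_(k < T) (act k)%:R * H (lam k) -
    \sum_(k < T) (act k)%:R * hinge (lam k) (v k.+1) <= 7 * V * Z.
  by apply: le_trans hinge_dev; rewrite -sumrB ler_sum// => k _; rewrite mulrBr.
have sumg : \sum_(1 <= k < T) (act k)%:R * ((u - lam k) * g k) =
    u * (\sum_(1 <= k < T) (act k)%:R * spend k) -
    u * rho * (\sum_(1 <= k < T) (act k)%:R) -
    \sum_(1 <= k < T) (act k)%:R * (lam k * spend k) +
    rho * \sum_(1 <= k < T) (act k)%:R * lam k.
  rewrite !mulr_sumr -!sumrN -!big_split/=; apply: eq_bigr => k _.
  by rewrite /g; ring.
have laml : \sum_(k < T) (act k)%:R * lam k = \sum_(1 <= k < T) (act k)%:R * lam k.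
  by rewrite (sum_recl (fun k => (act k)%:R * lam k)) mulr0 add0r.
have act1 : \sum_(1 <= k < T) (act k)%:R <= \sum_(k < T) (act k)%:R :> R.
  by rewrite (sum_recl (fun k => (act k)%:R)) lerDr.
have h1 := ler_wpM2l u0 spend_ge.
have h2 := ler_wpM2l (mulr_ge0 u0 (ltW rho0)) act1.
have h3 : u * (V + 2 * K * Z + 7 * V * Z) <= V / rho * (V + 2 * K * Z + 7 * V * Z).
  apply: ler_wpM2r => //; have := mulr_ge0 K0 Z0; have := mulr_ge0 Vr Z0; lra_params.
have h4 := ler_wpM2l u0 cst.
have h5 : om * (T%:R - \sum_(k < T) (act k)%:R) <= V * (T%:R - \sum_(k < T) (act k)%:R).
  by rewrite ler_wpM2r// subr_ge0.
have VZ : V <= 2 * (V * Z) by have := ler_wpM2l Vr one_le; lra_params.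
have VrZ : V / rho * V <= V / rho * (2 * (V * Z)).
  by apply: ler_wpM2l => //; exact: le_trans uV.
have VrE : V ^+ 2 / rho = V / rho * V by ring.
have h6 := budget_bound; have h7 := purchases_ge; rewrite VrE in h6.
rewrite /regret_const.
rewrite laml in dual.
exact: (regret_accounting (le_trans ogd ogdZ) dual rew cst hin sumg h1 h2 h3 h4 h5
  VZ VrZ h6 h7).
Qed.

End Regret.

(** * Measurability and deviation events *)

Section MeasurableTrajectory.
Context (d : measure_display) (W : measurableType d) (R : realType).
Variables (V rho : R) (T : nat) (v p : nat -> W -> R).

Let S k w := ogd_prefix V rho T (v^~ w) (p^~ w) k.
Let buys k w := ogd_buys V rho T (v^~ w) (p^~ w) k.
Let act k w := ogd_active V rho T (v^~ w) (p^~ w) k.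

Lemma measurable_fun_natb (b : W -> bool) : measurable_fun setT b ->
  measurable_fun setT (fun w => (b w)%:R : R).
Proof.
move=> mb; rewrite (_ : (fun w => _) = (fun w => if b w then 1 else 0)).
  exact: measurable_fun_ifT.
by apply/funext => w; case: (b w).
Qed.

Lemma measurable_reward (f g : W -> R) : measurable_fun setT f -> measurable_fun setT g ->
  measurable_fun setT (fun w => reward (f w) (g w)).
Proof. by move=> mf mg; apply: measurable_maxr => //; exact: measurable_funB. Qed.

Lemma measurable_cost (f g : W -> R) : measurable_fun setT f -> measurable_fun setT g ->
  measurable_fun setT (fun w => cost (f w) (g w)).
Proof.
by move=> mf mg; apply: measurable_fun_ifT => //; exact: measurable_fun_ler.
Qed.

Let observed n := forall t, (0 < t <= n)%N ->
  measurable_fun setT (v t) /\ measurable_fun setT (p t).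

(** The list of observations enters the algorithm only through its size and its sums, which the
    purchase indicators and the prices determine; hence the indicators stand in for it. *)
Let state_measurable n :=
  [/\ measurable_fun setT (fun w => st_lam (S n w)),
      measurable_fun setT (fun w => st_budget (S n w)),
      measurable_fun setT (act n) &
      forall k, (k < n)%N -> measurable_fun setT (buys k)].

(** The size is a measurable map into the discrete [nat], so any function of it, such as the bonus
    or the reciprocal, is measurable. *)
Let measurable_size_fun n (g : nat -> R) : state_measurable n ->
  measurable_fun setT (fun w => g (size (st_obs (S n w)))).
Proof.
case=> _ _ _ mb.
apply: (@measurableT_comp _ _ _ _ nat) => //.
suff H k : (k <= n)%N -> measurable_fun setT (fun w => (\sum_(j < k) buys j w)%N).
  have := H n (leqnn n); congr (measurable_fun _ _).
  by apply/funext => w; rewrite size_st_obs_prefix.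
elim: k => [|k IH] kn.
  rewrite (_ : (fun w => _) = cst 0%N)//.
  by apply/funext => w; rewrite big_ord0.
rewrite (_ : (fun w => _) = (fun w => ((\sum_(j < k) buys j w) + buys k w)%N)).
  apply: measurable_fun_addn; first exact: IH (ltnW kn).
  rewrite (_ : (fun w => _) = (fun w => if buys k w then 1%N else 0%N)).
    by apply: measurable_fun_ifT => //; exact: mb.
  by apply/funext => w; case: (buys k w).
by apply/funext => w; rewrite big_ord_recr.
Qed.

Let measurable_mean n (f : R -> R -> R) : state_measurable n -> observed n ->
  measurable_fun setT (v n.+1) ->
  (forall t, (0 < t <= n)%N -> measurable_fun setT (fun w => f (v n.+1 w) (p t w))) ->
  measurable_fun setT (fun w => mean_over (st_obs (S n w)) (f (v n.+1 w))).
Proof.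
move=> st obs mv mf; apply: measurable_funM; last first.
  exact: (measurable_size_fun (fun k => (k%:R)^-1)).
rewrite (_ : (fun w => _) =
    (fun w => \sum_(k < n) (buys k w)%:R * f (v n.+1 w) (p k.+1 w))); last first.
  by apply/funext => w; rewrite sum_st_obs_prefix.
apply: measurable_sum => k; apply: measurable_funM; last by apply: mf => /=.
by apply: measurable_fun_natb; case: st => _ _ _; apply.
Qed.

Let measurable_ct n : state_measurable n -> observed n -> measurable_fun setT (v n.+1) ->
  measurable_fun setT (fun w => ogd_ct T (st_obs (S n w)) (v n.+1 w)).
Proof.
move=> st obs mv; apply: measurable_funB.
  by apply: (measurable_mean (f := @cost R)) => // t /obs[_ mp]; exact: measurable_cost.
apply: measurable_funM => //; apply: measurable_funM => //.
exact: (measurable_size_fun (fun k => Num.sqrt ((ln 2 + 2 * ln T%:R) / (2 * k%:R)))).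
Qed.

Let measurable_rt n : state_measurable n -> observed n -> measurable_fun setT (v n.+1) ->
  measurable_fun setT (fun w => ogd_rt T (st_obs (S n w)) (v n.+1 w)).
Proof.
move=> st obs mv; apply: measurable_funD.
  by apply: (measurable_mean (f := @reward R)) => // t /obs[_ mp]; exact: measurable_reward.
apply: measurable_funM => //.
exact: (measurable_size_fun (fun k => Num.sqrt ((ln 2 + 2 * ln T%:R) / (2 * k%:R)))).
Qed.

Let measurable_buys_step n : state_measurable n -> observed n ->
  measurable_fun setT (v n.+1) -> measurable_fun setT (buys n).
Proof.
move=> st obs mv; have [ml _ ma _] := st; apply: measurable_and => //.
apply: measurable_or => //; apply: measurable_fun_ler.
  by apply: measurable_funM => //; exact: measurable_ct.
exact: measurable_rt.
Qed.

(** [W] is arbitrary and only the first n rounds are assumed measurable. Taking [past] for [W] turns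
    measurability into adaptedness of multiplier and activity and predictability of purchases. *)
Lemma measurable_state n : observed n -> state_measurable n.
Proof.
elim: n => [_|n IH obs]; first by split => //; exact: measurable_cst.
have obsn : observed n by move=> t /andP[t0 tn]; apply: obs; rewrite t0 ltnW.
have st := IH obsn; have [ml mB ma mb] := st.
have [mv mp] : measurable_fun setT (v n.+1) /\ measurable_fun setT (p n.+1).
  by apply: obs; rewrite /= leqnn.
have mbn := measurable_buys_step st obsn mv.
have mB' : measurable_fun setT (fun w => st_budget (S n.+1 w)).
  rewrite (_ : (fun w => _) = (fun w => st_budget (S n w) -
      (buys n w)%:R * cost (v n.+1 w) (p n.+1 w))).
    apply: measurable_funB => //; apply: measurable_funM.
      exact: measurable_fun_natb.
    exact: measurable_cost.
  by apply/funext => w; rewrite !st_budget_prefix big_ord_recr opprD addrA.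
split => //.
- case: n => [|n] in ml mB ma mb st IH obs obsn mv mp mbn mB' *.
    by under eq_fun do rewrite /S st_lam_prefix1.
  under eq_fun do rewrite /S st_lam_prefixS//.
  apply: measurable_fun_ifT => //; apply: measurable_maxr => //.
  apply: measurable_funD => //; apply: measurable_funM => //.
  apply: measurable_funB => //; apply: measurable_fun_ifT => //.
  exact: measurable_ct.
- rewrite (_ : act n.+1 = (fun w => act n w && ~~ (st_budget (S n.+1 w) < V))).
    apply: measurable_and => //; apply: measurable_neg.
    exact: measurable_fun_ltr.
  apply/funext => w; rewrite /act; have [a|na] := boolP (ogd_active V rho T (v^~ w) (p^~ w) n).
    by rewrite /ogd_active /S ogd_prefixS ogd_stepE.
  by apply/negbTE; rewrite /ogd_active ogd_prefix_inactive.
- by move=> k; rewrite ltnS leq_eqVlt => /predU1P[->//|]; exact: mb.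
Qed.

Lemma measurable_st_lam n :
  (forall t, (0 < t <= n)%N -> measurable_fun setT (v t) /\ measurable_fun setT (p t)) ->
  measurable_fun setT (fun w => st_lam (ogd_prefix V rho T (v^~ w) (p^~ w) n)).
Proof. by case/measurable_state. Qed.

Lemma measurable_ogd_active n :
  (forall t, (0 < t <= n)%N -> measurable_fun setT (v t) /\ measurable_fun setT (p t)) ->
  measurable_fun setT (fun w => ogd_active V rho T (v^~ w) (p^~ w) n).
Proof. by case/measurable_state. Qed.

Lemma measurable_ogd_buys n :
  (forall t, (0 < t <= n)%N -> measurable_fun setT (v t) /\ measurable_fun setT (p t)) ->
  measurable_fun setT (v n.+1) ->
  measurable_fun setT (fun w => ogd_buys V rho T (v^~ w) (p^~ w) n).
Proof. by move=> obs mv; apply: measurable_buys_step => //; exact: measurable_state. Qed.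

End MeasurableTrajectory.

(** * Deviation of a new variable from its mean given the past *)

Section InnovationMean.
Context (R : realType) (Q : probability R R) (f : R * R -> R).
Hypothesis mf : measurable_fun setT f.
Hypothesis f0 : forall z, 0 <= f z.

(** The conditional mean of f (x, Y) given x, for Y of law [Q] independent of x. *)
Definition section_mean (x : R) : R := fine (\int[Q]_y (f (x, y))%:E).

Lemma measurable_section (x : R) : measurable_fun setT (fun y => f (x, y)).
Proof. exact: (measurableT_comp mf (measurable_pair1 x)). Qed.

Lemma measurable_section_mean : measurable_fun setT section_mean.
Proof.
apply: (@measurableT_comp _ _ _ _ (\bar R)); first exact: fine_measurable.
apply: (@measurable_fun_fubini_tonelli_F _ _ _ _ _ Q (EFin \o f)).
- by apply/measurable_EFinP.
- by move=> z; rewrite lee_fin.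
Qed.

Variables (b x : R).
Hypothesis fb : forall y, f (x, y) <= b.

Let normf y : `|f (x, y)| <= b. Proof. by rewrite ger0_norm. Qed.

Lemma section_meanE : (section_mean x)%:E = (\int[Q]_y (f (x, y))%:E)%E.
Proof.
rewrite /section_mean fineK//; apply: integrable_fin_num => //.
exact: (bounded_integrable Q (measurable_section x) normf).
Qed.

Lemma section_mean_bound : 0 <= section_mean x <= b.
Proof.
rewrite -!lee_fin section_meanE integral_ge0/=; last by move=> y _; rewrite lee_fin.
rewrite -[leRHS](integral_cst_prob Q) ge0_le_integral//.
- by move=> y _; rewrite lee_fin.
- by apply/measurable_EFinP; exact: measurable_section.
- by move=> y _; rewrite lee_fin.
Qed.

Lemma integral_sub_section_mean (z : R) :
  (\int[Q]_y (z * (f (x, y) - section_mean x))%:E = 0)%E.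
Proof.
have i1 := bounded_integrable Q (measurable_section x) normf.
have i2 : Q.-integrable setT (EFin \o cst (section_mean x)).
  by apply: (bounded_integrable Q (b := `|section_mean x|)).
under eq_integral do rewrite EFinM.
rewrite integralZl//; last first.
  rewrite (_ : (fun y => _) = (fun y => ((EFin \o (fun y => f (x, y))) y -
    (EFin \o cst (section_mean x)) y)%E)); first exact: integrableB.
  by apply/funext => y /=; rewrite EFinB.
under eq_integral do rewrite EFinB.
by rewrite integralB// integral_cst_prob -section_meanE subee// mule0.
Qed.

End InnovationMean.

Section InnovationTail.
Context (d : measure_display) (Omega : measurableType d) (R : realType).
Context (P : probability Omega R) (I : eqType) (s : seq I) (X : I -> Omega -> R).
Hypothesis mX : forall i, measurable_fun setT (X i).
Hypothesis s_uniq : uniq s.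
Hypothesis X_indep : mutually_independent P s X.

Variables (Q : probability R R) (J : nat -> pred I) (i : nat -> I) (n m : nat).
Variables (f : R * R -> R) (z x : nat -> Omega -> R) (b L : R).
Hypothesis i_s : forall k, (k < n)%N -> i k \in s.
Hypothesis iJ : forall k, ~~ J k (i k).
Hypothesis iJS : forall k, J k.+1 (i k).
Hypothesis JS : forall k, {subset J k <= J k.+1}.
Hypothesis law_i : forall k, (k < n)%N ->
  forall B, measurable B -> P (X (i k) @^-1` B) = Q B.
Hypothesis mf : measurable_fun setT f.
Hypothesis f0 : forall t, 0 <= f t.
Hypothesis fb : forall k w y, f (x k w, y) <= b.
Hypothesis z1 : forall k w, `|z k w| <= 1.
Hypothesis mz : forall k, (k < n)%N -> measurable_fun setT (z k : past s X (J k) -> R).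
Hypothesis mx : forall k, (k < n)%N -> measurable_fun setT (x k : past s X (J k) -> R).
Hypotheses (b0 : 0 < b) (L0 : 0 < L) (m0 : (0 < m)%N) (nm : (n <= m)%N).

(** The weight [z k] and the argument [x k] are known before [X (i k)], so each term is centred
    given the past. It is bounded by b because f and its section mean both lie in [0, b] and the
    weight has modulus at most 1. *)
Lemma innovation_tail (E := [set w | 7 * b * Num.sqrt (m%:R * L) <=
    \sum_(k < n) z k w * (f (x k w, X (i k) w) - section_mean Q f (x k w))]) :
  measurable E /\ (P E <= (expR (- (3 * L)))%:E)%E.
Proof.
pose psi k (u : Omega * R) := z k u.1 * (f (x k u.1, u.2) - section_mean Q f (x k u.1)).
have mpsi k : (k < n)%N -> measurable_fun setT (psi k : past s X (J k) * R -> R).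
  move=> kn; pose T1 := past s X (J k).
  have m1 : measurable_fun setT (fst : T1 * R -> T1) by exact: measurable_fst.
  have mz1 : measurable_fun setT (fun u : T1 * R => z k u.1).
    exact: (measurableT_comp (mz kn) m1).
  have mx1 : measurable_fun setT (fun u : T1 * R => x k u.1).
    exact: (measurableT_comp (mx kn) m1).
  apply: (@measurable_funM _ (T1 * R)%type) => //.
  apply: (@measurable_funB _ (T1 * R)%type).
    apply: (@measurableT_comp _ _ _ _ (R * R)%type) => //.
    by apply: measurable_fun_pair => //; exact: measurable_snd.
  by apply: (@measurableT_comp _ _ _ _ R) => //; exact: measurable_section_mean.
have psib k u : (k < n)%N -> `|psi k u| <= b.
  move=> kn; rewrite /psi normrM -[leRHS]mul1r ler_pM//.
  have := section_mean_bound Q mf f0 (fb k u.1); have := f0 (x k u.1, u.2).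
  have := fb k u.1 u.2 => h1 h2 /andP[h3 h4].
  by rewrite ler_norml; apply/andP; split; lra.
have psi0 k w : (k < n)%N -> (\int[Q]_y (psi k (w, y))%:E = 0)%E.
  by move=> kn; exact: (integral_sub_section_mean Q mf f0 (fb k w) (z k w)).
split; last first.
  by have := martingale_tail mX s_uniq X_indep i_s (fun k _ => iJ k)
    (fun k _ => iJS k) JS law_i mpsi psib psi0 b0 L0 m0 nm.
have mS := measurable_martingale mX i_s (fun k _ => iJS k) JS mpsi.
by rewrite -[E]setTI; apply: measurable_fun_le.
Qed.

End InnovationTail.

(** * Deviation events for values and prices bounded everywhere *)

Section BoundedRounds.
Context (d : measure_display) (Omega : measurableType d) (R : realType).
Context (P : probability Omega R) (F G : probability R R).
Variables (V rho : R) (T : nat) (v p : nat -> Omega -> R).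
Hypotheses (V0 : 0 < V) (rho0 : 0 < rho) (rhoV : rho <= V) (T2 : (1 < T)%N).
Hypothesis vb : forall t w, 0 <= v t w <= V.
Hypothesis pb : forall t w, 0 <= p t w <= V.
Hypothesis mv : forall t, measurable_fun setT (v t).
Hypothesis mp : forall t, measurable_fun setT (p t).
Hypothesis law_v : forall t, (1 <= t <= T)%N ->
  forall A, measurable A -> P (v t @^-1` A) = F A.
Hypothesis law_p : forall t, (1 <= t <= T)%N ->
  forall A, measurable A -> P (p t @^-1` A) = G A.

Let s : seq (nat + nat) := [seq inl t | t <- iota 1 T] ++ [seq inr t | t <- iota 1 T].
Let X := vp_family v p.
Hypothesis X_indep : mutually_independent P s X.

Variables (freward fcost : R * R -> R).
Hypotheses (mfr : measurable_fun setT freward) (mfc : measurable_fun setT fcost).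
Hypotheses (fr_bound : forall u, 0 <= freward u <= V) (fc_bound : forall u, 0 <= fcost u <= V).
Hypothesis frE : forall x y : R, 0 <= x <= V -> 0 <= y <= V -> freward (x, y) = reward x y.
Hypothesis fcE : forall x y : R, 0 <= x <= V -> 0 <= y <= V -> fcost (x, y) = cost x y.

(** The argument is the pair (multiplier, value); its section mean under [F] is the dual function
    H. *)
Definition mean_hinge (u : R * R) : R :=
  Num.max (section_mean G freward u.2 - u.1 * section_mean G fcost u.2) 0.

Let L : R := ln T%:R.
Let L0 : 0 < L. Proof. by rewrite ln_gt0// ltr1n. Qed.

Let act k w := ogd_active V rho T (v^~ w) (p^~ w) k.
Let buys k w := ogd_buys V rho T (v^~ w) (p^~ w) k.
Let lam k w := st_lam (ogd_prefix V rho T (v^~ w) (p^~ w) k).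

Let mX i : measurable_fun setT (X i). Proof. by case: i. Qed.

Let s_uniq : uniq s.
Proof.
rewrite cat_uniq !map_inj_uniq ?iota_uniq//=; try by move=> ? ? [].
by rewrite andbT; apply/hasPn => _ /mapP[t _ ->]; apply/mapP => -[].
Qed.

Let inl_s t : (inl t \in s) = (0 < t <= T)%N.
Proof.
rewrite mem_cat; have -> : ((inl t : nat + nat) \in [seq inr t' | t' <- iota 1 T]) = false.
  by apply/mapP => -[].
by rewrite orbF mem_map ?mem_iota ?add1n ?ltnS// => ? ? [].
Qed.

Let inr_s t : (inr t \in s) = (0 < t <= T)%N.
Proof.
rewrite mem_cat; have -> : ((inr t : nat + nat) \in [seq inl t' | t' <- iota 1 T]) = false.
  by apply/mapP => -[].
by rewrite /= mem_map ?mem_iota ?add1n ?ltnS// => ? ? [].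
Qed.

(* All values, future ones included, are revealed before the prices, so that the fixed
   value v_(k+1) may enter deviations of earlier prices. *)
Let before_price (k : nat) : pred (nat + nat) :=
  fun i => match i with inl _ => true | inr t => (t <= k)%N end.

(** Here the new variable is v_(k+1), so only the first k rounds are known; they already determine
    lambda and the activity of round k + 1. *)
Let before_value (k : nat) : pred (nat + nat) :=
  fun i => match i with inl t => (t <= k)%N | inr t => (t <= k)%N end.

Let mv_past (J : pred (nat + nat)) t : (0 < t <= T)%N -> J (inl t) ->
  measurable_fun setT (v t : past s X J -> R).
Proof. by move=> tT Jt; apply: (@measurable_past_var _ _ _ _ s X J (inl t)); rewrite ?inl_s. Qed.

Let mp_past (J : pred (nat + nat)) t : (0 < t <= T)%N -> J (inr t) ->
  measurable_fun setT (p t : past s X J -> R).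
Proof. by move=> tT Jt; apply: (@measurable_past_var _ _ _ _ s X J (inr t)); rewrite ?inr_s. Qed.

Let price_tail (f : R * R -> R) (z x : nat -> Omega -> R) (n m : nat)
    (E := [set w | 7 * V * Num.sqrt (m%:R * L) <=
    \sum_(k < n) z k w * (f (x k w, p k.+1 w) - section_mean G f (x k w))]) :
  measurable_fun setT f -> (forall u, 0 <= f u <= V) ->
  (forall k w, `|z k w| <= 1) ->
  (forall k, (k < n)%N -> measurable_fun setT (z k : past s X (before_price k) -> R)) ->
  (forall k, (k < n)%N -> measurable_fun setT (x k : past s X (before_price k) -> R)) ->
  (n <= T)%N -> (0 < m)%N -> (n <= m)%N ->
  measurable E /\ (P E <= (expR (- (3 * L)))%:E)%E.
Proof.
move=> mf fV z1 mz mx nT m0 nm.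
apply: (@innovation_tail _ _ _ P _ s X mX s_uniq X_indep G before_price (fun k => inr k.+1)
  n m f z x V L) => //.
- by move=> k kn; rewrite inr_s /= (leq_trans kn).
- by move=> k; rewrite /= ltnn.
- by move=> k /=.
- by move=> k [t|t]; rewrite !unfold_in //= => /leqW.
- by move=> k kn B mB; apply: law_p => //; rewrite /= (leq_trans kn).
- by move=> u; case/andP: (fV u).
- by move=> k w y; case/andP: (fV (x k w, y)).
Qed.

Let value_tail (f : R * R -> R) (z x : nat -> Omega -> R)
    (E := [set w | 7 * V * Num.sqrt (T%:R * L) <=
    \sum_(k < T) z k w * (f (x k w, v k.+1 w) - section_mean F f (x k w))]) :
  measurable_fun setT f -> (forall u, 0 <= f u) -> (forall k w y, f (x k w, y) <= V) ->
  (forall k w, `|z k w| <= 1) ->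
  (forall k, (k < T)%N -> measurable_fun setT (z k : past s X (before_value k) -> R)) ->
  (forall k, (k < T)%N -> measurable_fun setT (x k : past s X (before_value k) -> R)) ->
  measurable E /\ (P E <= (expR (- (3 * L)))%:E)%E.
Proof.
move=> mf f0 fV z1 mz mx.
apply: (@innovation_tail _ _ _ P _ s X mX s_uniq X_indep F before_value (fun k => inl k.+1)
  T T f z x V L) => //.
- by move=> k kn; rewrite inl_s.
- by move=> k; rewrite /= ltnn.
- by move=> k /=.
- by move=> k [t|t]; rewrite !unfold_in /= => /leqW.
- by move=> k kn B mB; apply: law_v.
- exact: ltnW.
Qed.

Let norm_natb (b : bool) : `|b%:R : R| <= 1.
Proof. by case: b; rewrite ?normr1 ?normr0. Qed.

Let mbuys k : (k < T)%N ->
  measurable_fun setT (fun w : past s X (before_price k) => (buys k w)%:R : R).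
Proof.
move=> kT; apply: measurable_fun_natb.
apply: (@measurable_ogd_buys _ (past s X (before_price k)) _ V rho T v p k).
  move=> t /andP[t0 tk]; have tT := leq_trans tk (ltnW kT).
  by split; [apply: mv_past|apply: mp_past]; rewrite ?t0 ?tT.
exact: mv_past.
Qed.

Let known_before_value k : (k < T)%N -> forall t, (0 < t <= k)%N ->
  measurable_fun setT (v t : past s X (before_value k) -> R) /\
  measurable_fun setT (p t : past s X (before_value k) -> R).
Proof.
move=> kT t /andP[t0 tk]; have tT := leq_trans tk (ltnW kT).
by split; [apply: mv_past|apply: mp_past]; rewrite ?t0 ?tT.
Qed.

Let msign (b : bool) k : (k < T)%N -> measurable_fun setT
  (fun w : past s X (before_price k) => (-1) ^+ b * (buys k w)%:R : R).
Proof. by move=> kT; apply: measurable_funM => //; exact: mbuys. Qed.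

Let norm_sign (b : bool) k w : `|(-1) ^+ b * (buys k w)%:R : R| <= 1.
Proof. by rewrite normrM normrX normrN1 expr1n mul1r. Qed.

(** One-sided: [b = true] means that the mean exceeds the realisations, [b = false] the converse. *)
Definition price_event (f : R * R -> R) (b : bool) (x : nat -> Omega -> R) (n : nat) :
    set Omega :=
  [set w | 7 * V * Num.sqrt (n%:R * L) <= \sum_(k < n) (-1) ^+ b * (buys k w)%:R *
     (f (x k w, p k.+1 w) - section_mean G f (x k w))].

Let price_eventP (f : R * R -> R) b x n : measurable_fun setT f -> (forall u, 0 <= f u <= V) ->
  (forall k, (k < n)%N -> measurable_fun setT (x k : past s X (before_price k) -> R)) ->
  (0 < n <= T)%N ->
  measurable (price_event f b x n) /\
  (P (price_event f b x n) <= (expR (- (3 * L)))%:E)%E.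
Proof.
move=> mf fV mx /andP[n0 nT].
apply: (price_tail (z := fun k w => (-1) ^+ b * (buys k w)%:R) (x := x)) => //.
by move=> k kn; apply: msign; exact: leq_trans kn nT.
Qed.

Let value_event : set Omega :=
  [set w | 7 * V * Num.sqrt (T%:R * L) <= \sum_(k < T) - (act k w)%:R *
    (mean_hinge (lam k w, v k.+1 w) - section_mean F mean_hinge (lam k w))].

Lemma measurable_mean_hinge : measurable_fun setT mean_hinge.
Proof.
have frp u : 0 <= freward u by case/andP: (fr_bound u).
have fcp u : 0 <= fcost u by case/andP: (fc_bound u).
have mR : measurable_fun setT (fun u : R * R => section_mean G freward u.2).
  exact: (measurableT_comp (measurable_section_mean G mfr frp) measurable_snd).
have mC : measurable_fun setT (fun u : R * R => section_mean G fcost u.2).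
  exact: (measurableT_comp (measurable_section_mean G mfc fcp) measurable_snd).
by apply: measurable_maxr => //; apply: measurable_funB => //; apply: measurable_funM.
Qed.

Lemma mean_reward_bound x : 0 <= section_mean G freward x <= V.
Proof.
by apply: section_mean_bound => // u; [case/andP: (fr_bound u)|case/andP: (fr_bound (x, u))].
Qed.

Lemma mean_cost_bound x : 0 <= section_mean G fcost x <= V.
Proof.
by apply: section_mean_bound => // u; [case/andP: (fc_bound u)|case/andP: (fc_bound (x, u))].
Qed.

Let value_eventP : measurable value_event /\ (P value_event <= (expR (- (3 * L)))%:E)%E.
Proof.
apply: (value_tail (z := fun k w => - (act k w)%:R) (x := lam)).
- exact: measurable_mean_hinge.
- by move=> u; rewrite /mean_hinge le_max lexx orbT.
- move=> k w y; rewrite /mean_hinge ge_max (ltW V0) andbT /=.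
  have /andP[_ h1] := mean_reward_bound y; have /andP[h2 _] := mean_cost_bound y.
  by apply: le_trans h1; rewrite lerBlDr lerDl mulr_ge0// st_lam_prefix_ge0.
- by move=> k w; rewrite normrN.
- move=> k kT; apply: measurable_funN; apply: measurable_fun_natb.
  exact: (@measurable_ogd_active _ (past s X (before_value k)) _ V rho T v p k
    (known_before_value kT)).
- move=> k kT.
  exact: (@measurable_st_lam _ (past s X (before_value k)) _ V rho T v p k
    (known_before_value kT)).
Qed.

Let fixed (k : nat) : nat -> Omega -> R := fun _ => v k.+1.

(* k = 0 carries the three whole-horizon deviations, k > 0 the estimates used in round k+1. *)
Definition deviation_event (k : nat) : set Omega :=
  if k == 0%N then price_event freward true (fun j => v j.+1) T `|`
    price_event fcost false (fun j => v j.+1) T `|` value_event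
  else price_event freward true (fixed k) k `|` price_event freward false (fixed k) k `|`
    price_event fcost true (fixed k) k `|` price_event fcost false (fixed k) k.

Let prob_setU_le (A B : set Omega) (a b : R) :
  measurable A /\ (P A <= a%:E)%E -> measurable B /\ (P B <= b%:E)%E ->
  measurable (A `|` B) /\ (P (A `|` B) <= (a + b)%:E)%E.
Proof.
move=> [mA PA] [mB PB]; split; first exact: measurableU.
by apply: le_trans (measureU2 P mA mB) _; rewrite EFinD leeD.
Qed.

Lemma deviation_eventP k : (k < T)%N ->
  measurable (deviation_event k) /\
  (P (deviation_event k) <= (4 * expR (- (3 * L)))%:E)%E.
Proof.
move=> kT; rewrite /deviation_event; set e := expR _.
have e0 : 0 <= e by exact: expR_ge0.
have T1 : (0 < T <= T)%N by rewrite ltnW//=.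
have mvT k' : (k' < T)%N -> measurable_fun setT (v k'.+1 : past s X (before_price k') -> R).
  by move=> k'T; apply: mv_past.
case: eqP => [_|/eqP k0].
  have E1 := price_eventP true mfr fr_bound mvT T1.
  have E2 := price_eventP false mfc fc_bound mvT T1.
  have [mE PE] := prob_setU_le (prob_setU_le E1 E2) value_eventP; split => //.
  by apply: le_trans PE _; rewrite lee_fin -/e; lra.
have kk : (0 < k <= T)%N by rewrite lt0n k0 ltnW.
have mk j : (j < k)%N -> measurable_fun setT (fixed k j : past s X (before_price j) -> R).
  by move=> jk; apply: mv_past.
have E1 := price_eventP true mfr fr_bound mk kk.
have E2 := price_eventP false mfr fr_bound mk kk.
have E3 := price_eventP true mfc fc_bound mk kk.
have E4 := price_eventP false mfc fc_bound mk kk.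
have [mE PE] := prob_setU_le (prob_setU_le (prob_setU_le E1 E2) E3) E4; split => //.
by apply: le_trans PE _; rewrite lee_fin -/e; lra.
Qed.

(** Over the whole horizon only the harmful sign is excluded: mean reward above realised reward,
    actual cost above mean cost, dual function above hinge. The estimates used by the purchase rule
    need both signs. *)
Lemma regret_off_deviations w om :
  (forall k, (k < T)%N -> ~ deviation_event k w) ->
  (forall l, 0 <= l -> om <= section_mean F mean_hinge l + l * rho) -> om <= V ->
  T%:R * om - ogd_revenue V rho T (v^~ w) (p^~ w) <=
  regret_const V rho * Num.sqrt (T%:R * L).
Proof.
move=> good dual omV.
have good0 := good 0%N (ltnW T2).
have frv t t' : freward (v t w, p t' w) = reward (v t w) (p t' w) by exact: frE.
have fcv t t' : fcost (v t w, p t' w) = cost (v t w) (p t' w) by exact: fcE.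
rewrite /deviation_event eqxx in good0.
have [ng1 ng2 ng3] : [/\ ~ price_event freward true (fun j => v j.+1) T w,
    ~ price_event fcost false (fun j => v j.+1) T w & ~ value_event w].
  by split => h; apply: good0; [left; left|left; right|right].
have goodk k : (0 < k < T)%N -> [/\ ~ price_event freward true (fixed k) k w,
    ~ price_event freward false (fixed k) k w,
    ~ price_event fcost true (fixed k) k w & ~ price_event fcost false (fixed k) k w].
  move=> /andP[k0 kT]; have := good k kT; rewrite /deviation_event gtn_eqF//.
  by move=> ng; split => h; apply: ng; [do 3 left|do 2 left; right|left; right|right].
have notle (a b : R) : ~ (a <= b) -> b <= a by move=> /negP; rewrite -ltNge => /ltW.
apply: (@ogd_regret_bound R V rho T (v^~ w) (p^~ w) V0 rho0 rhoV T2 _ _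
  (section_mean G freward) (section_mean G fcost) (section_mean F mean_hinge) om) => //.
- exact: mean_reward_bound.
- exact: mean_cost_bound.
- apply: le_trans (notle _ _ ng1); apply: ler_sum => k _.
  by rewrite frv expr1 mulN1r mulNr -mulrN opprB.
- apply: le_trans (notle _ _ ng2); apply: ler_sum => k _.
  by rewrite fcv expr0 mul1r.
- apply: le_trans (notle _ _ ng3); apply: ler_sum => k _.
  by rewrite mulNr -mulrN opprB.
- move=> k kT; have [g1 g2 _ _] := goodk k kT; rewrite ler_norml; apply/andP; split.
    rewrite lerNl; apply: le_trans (notle _ _ g1); rewrite -sumrN; apply: ler_sum => j _.
    by rewrite frv expr1 mulN1r mulNr.
  by apply: le_trans (notle _ _ g2); apply: ler_sum => j _; rewrite frv expr0 mul1r.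
- move=> k kT; have [_ _ g1 g2] := goodk k kT; rewrite ler_norml; apply/andP; split.
    rewrite lerNl; apply: le_trans (notle _ _ g1); rewrite -sumrN; apply: ler_sum => j _.
    by rewrite fcv expr1 mulN1r mulNr.
  by apply: le_trans (notle _ _ g2); apply: ler_sum => j _; rewrite fcv expr0 mul1r.
Qed.

End BoundedRounds.

(** * Clipping, weak duality and the main bound *)

Section Clip.
Context (R : realType) (V : R).
Hypothesis V0 : 0 <= V.

(** The trajectory bounds need values and prices in [0, V] at every sample point, the laws give this
    almost surely. Clipping preserves laws and independence and leaves points of the interval
    unchanged. *)
Definition clip (x : R) : R := Num.min (Num.max x 0) V.

Lemma clip_bound x : 0 <= clip x <= V.
Proof. by rewrite /clip le_min le_max lexx orbT V0 ge_min lexx orbT. Qed.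

Lemma clip_id x : 0 <= x <= V -> clip x = x.
Proof. by move=> /andP[x0 xV]; rewrite /clip max_l// min_l. Qed.

Lemma measurable_clip : measurable_fun setT clip.
Proof. by apply: measurable_minr => //; exact: measurable_maxr. Qed.

Context (Q : probability R R).
Hypothesis Q1 : Q `[0, V]%classic = 1%E.

Lemma outside_itv_null : Q (~` `[0, V]%classic) = 0%E.
Proof. by rewrite probability_setC// Q1 subee. Qed.

Lemma ae_eq_in_itv (U : Type) (f g : R -> U) :
  (forall x, 0 <= x <= V -> f x = g x) -> ae_eq Q setT f g.
Proof.
move=> fg; exists (~` `[0, V]%classic); split.
- exact: measurableC.
- exact: outside_itv_null.
- move=> x /= nfg; rewrite in_itv /= => xI; apply: nfg => _; exact: fg.
Qed.

Lemma integral_clip (g : R -> \bar R) : measurable_fun setT g ->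
  (\int[Q]_x g x = \int[Q]_x g (clip x))%E.
Proof.
move=> mg; apply: ae_eq_integral => //.
  by apply: measurableT_comp => //; exact: measurable_clip.
by apply: ae_eq_in_itv => x xI; rewrite clip_id.
Qed.

Lemma clip_law (A : set R) : measurable A -> Q (clip @^-1` A) = Q A.
Proof.
move=> mA; have mcA : measurable (clip @^-1` A).
  by rewrite -[X in measurable X]setTI; exact: measurable_clip.
rewrite -[X in _ = Q X]setIT -[X in Q X = _]setIT -!integral_indic//.
rewrite (integral_clip (g := fun x => (\1_A x)%:E))//.
by apply/measurable_EFinP; exact: measurable_indic.
Qed.

End Clip.

(** * Weak duality for one feasible policy *)

Section Duality.
Context (R : realType) (V rho : R) (F G : probability R R).
Hypothesis V0 : 0 < V.
Hypotheses (F1 : F `[0, V]%classic = 1%E) (G1 : G `[0, V]%classic = 1%E).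

Definition clipped_reward (u : R * R) : R := reward (clip V u.1) (clip V u.2).
Definition clipped_cost (u : R * R) : R := cost (clip V u.1) (clip V u.2).

Lemma measurable_clip_pair :
  measurable_fun setT (fun u : R * R => clip V u.1) /\
  measurable_fun setT (fun u : R * R => clip V u.2).
Proof.
by split; apply: measurableT_comp => //; exact: measurable_clip.
Qed.

Lemma measurable_clipped_reward : measurable_fun setT clipped_reward.
Proof. by have [m1 m2] := measurable_clip_pair; exact: measurable_reward. Qed.

Lemma measurable_clipped_cost : measurable_fun setT clipped_cost.
Proof. by have [m1 m2] := measurable_clip_pair; exact: measurable_cost. Qed.

Lemma clipped_reward_bound u : 0 <= clipped_reward u <= V.
Proof.
have /andP[x0 xV] := clip_bound (ltW V0) u.1; have /andP[y0 _] := clip_bound (ltW V0) u.2.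
by have /andP[h1 h2] := reward_bound x0 y0; rewrite h1 (le_trans h2).
Qed.

Lemma clipped_cost_bound u : 0 <= clipped_cost u <= V.
Proof.
have /andP[x0 xV] := clip_bound (ltW V0) u.1; have /andP[y0 _] := clip_bound (ltW V0) u.2.
by have /andP[h1 h2] := cost_bound x0 y0; rewrite h1 (le_trans h2).
Qed.

(** Replaces the extended-real iterated integral by the integral of a bounded real function. The
    price is clipped first, for every x, since the cost is nonnegative only at nonnegative prices;
    the value is then clipped for F-almost every x. *)
Lemma integral_policy (pol : R -> R) (g : R -> R -> R)
    (fg := fun u : R * R => g (clip V u.1) (clip V u.2)) :
  measurable_fun setT pol -> measurable_fun setT (fun u : R * R => g u.1 u.2) ->
  (forall x y, 0 <= y -> 0 <= g x y) -> (forall u, fg u <= V) ->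
  (\int[F]_x (EFin (pol x) * \int[G]_y EFin (g x y)) =
   \int[F]_x (pol x * section_mean G fg x)%:E)%E.
Proof.
move=> mpol mg g0 fV.
have clip0 y : 0 <= clip V y by case/andP: (clip_bound (ltW V0) y).
have mfg : measurable_fun setT fg.
  have [m1 m2] := measurable_clip_pair.
  exact: (measurableT_comp mg (measurable_fun_pair m1 m2)).
have fg0 u : 0 <= fg u by exact: g0.
have inner x : (\int[G]_y EFin (g x y) = \int[G]_y EFin (g x (clip V y)))%E.
  apply: (integral_clip G1 (g := fun y => (g x y)%:E)).
  by apply/measurable_EFinP; exact: (measurableT_comp mg (measurable_pair1 x)).
under eq_integral do rewrite inner.
apply: ae_eq_integral => //.
- apply: emeasurable_funM; first exact/measurable_EFinP.
  apply: (@measurable_fun_fubini_tonelli_F _ _ _ _ _ G (fun u => (g u.1 (clip V u.2))%:E)).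
    apply/measurable_EFinP.
    have [_ m2] := measurable_clip_pair.
    exact: (measurableT_comp mg (measurable_fun_pair measurable_fst m2)).
  by move=> u; rewrite lee_fin g0.
- apply/measurable_EFinP; apply: measurable_funM => //.
  exact: measurable_section_mean.
- apply: (ae_eq_in_itv F1) => x xI; rewrite EFinM.
  rewrite (section_meanE G mfg fg0 (b := V))//.
  by congr (_ * _)%E; apply: eq_integral => y _; rewrite /fg /= (clip_id xI).
Qed.

(** Pointwise pol r <= (r - l c)^+ + l pol c, as pol lies in [0, 1]; integrating and using
    feasibility gives the bound. Stating it for each policy avoids asking whether the supremum in
    [OPT] is attained. *)
Lemma policy_dual (pol : R -> R) : measurable_fun setT pol ->
  (forall x, 0 <= pol x <= 1) ->
  (\int[F]_x (EFin (pol x) * \int[G]_y EFin (cost x y)) <= rho%:E)%E ->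
  exists om : R,
    [/\ (\int[F]_x (EFin (pol x) * \int[G]_y EFin (reward x y)) = om%:E)%E, om <= V &
      forall l, 0 <= l ->
        om <= section_mean F (mean_hinge G clipped_reward clipped_cost) l + l * rho].
Proof.
move=> mpol pol01.
have mfst := @measurable_fst _ _ R R; have msnd := @measurable_snd _ _ R R.
have frb u : clipped_reward u <= V by case/andP: (clipped_reward_bound u).
have fcb u : clipped_cost u <= V by case/andP: (clipped_cost_bound u).
have rew_ge0 (x q : R) : 0 <= q -> 0 <= reward x q.
  by move=> _; rewrite /reward /pos_part le_max lexx orbT.
have cost_ge0 (x q : R) : 0 <= q -> 0 <= cost x q by rewrite /cost; case: ifP.
rewrite (integral_policy mpol (measurable_cost mfst msnd) cost_ge0 fcb).
rewrite (integral_policy mpol (measurable_reward mfst msnd) rew_ge0 frb).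
rewrite -/clipped_reward -/clipped_cost.
set r := section_mean G clipped_reward; set c := section_mean G clipped_cost => feas.
have r01 x : 0 <= r x <= V.
  exact: (mean_reward_bound _ measurable_clipped_reward clipped_reward_bound).
have c01 x : 0 <= c x <= V.
  exact: (mean_cost_bound _ measurable_clipped_cost clipped_cost_bound).
have mr : measurable_fun setT r.
  apply: measurable_section_mean; first exact: measurable_clipped_reward.
  by move=> u; case/andP: (clipped_reward_bound u).
have mc : measurable_fun setT c.
  apply: measurable_section_mean; first exact: measurable_clipped_cost.
  by move=> u; case/andP: (clipped_cost_bound u).
have mpr : measurable_fun setT (fun x => pol x * r x) by exact: measurable_funM.
have mpc : measurable_fun setT (fun x => pol x * c x) by exact: measurable_funM.
have pr0 x : 0 <= pol x * r x.
  by apply: mulr_ge0; [case/andP: (pol01 x)|case/andP: (r01 x)].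
have pc0 x : 0 <= pol x * c x.
  by apply: mulr_ge0; [case/andP: (pol01 x)|case/andP: (c01 x)].
have prV x : pol x * r x <= V.
  have /andP[p0 p1] := pol01 x; have /andP[r0 rV] := r01 x.
  by rewrite -[leRHS]mul1r ler_pM.
have ipr : (\int[F]_x (pol x * r x)%:E)%E \is a fin_num.
  apply: integrable_fin_num => //; apply: (bounded_integrable F (b := V)) => // x.
  by rewrite ger0_norm.
exists (fine (\int[F]_x (pol x * r x)%:E)%E); rewrite fineK//; split => //.
  rewrite -lee_fin fineK// -[leRHS](integral_cst_prob F).
  apply: ge0_le_integral => //.
  - by move=> x _; rewrite lee_fin.
  - by apply/measurable_EFinP.
  - by move=> x _; rewrite lee_fin.
move=> l l0.
have mh := measurable_mean_hinge G measurable_clipped_reward measurable_clipped_cost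
  clipped_reward_bound clipped_cost_bound.
have h0 u : 0 <= mean_hinge G clipped_reward clipped_cost u.
  by rewrite /mean_hinge le_max lexx orbT.
have mhl := measurable_section mh l.
rewrite -lee_fin fineK// EFinD (section_meanE F mh h0 (b := V)); last first.
  move=> x; rewrite /mean_hinge /= -/r -/c ge_max (ltW V0) andbT.
  have /andP[_ h1] := r01 x; have /andP[h2 _] := c01 x.
  by apply: le_trans h1; rewrite lerBlDr lerDl mulr_ge0.
apply: (@le_trans _ _ (\int[F]_x ((mean_hinge G clipped_reward clipped_cost (l, x))%:E +
    l%:E * (pol x * c x)%:E))%E).
  apply: ge0_le_integral => //.
  - by move=> x _; rewrite lee_fin.
  - by apply/measurable_EFinP.
  - apply: emeasurable_funD; first exact/measurable_EFinP.
    by apply: emeasurable_funM => //; exact/measurable_EFinP.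
  - move=> x _; rewrite -EFinM -EFinD lee_fin /mean_hinge /= -/r -/c.
    have /andP[p0 p1] := pol01 x.
    set h := Num.max _ _.
    have h1 : r x - l * c x <= h by rewrite /h le_max lexx.
    have h2 : 0 <= h by rewrite /h le_max lexx orbT.
    have := ler_wpM2l p0 h1; have := ler_wpM2r h2 p1; rewrite mul1r.
    by move: (pol x) (r x) (c x) (h) => a b e h'; lra.
rewrite ge0_integralD//; last 4 first.
- by move=> x _; rewrite lee_fin.
- exact/measurable_EFinP.
- by move=> x _; rewrite -EFinM lee_fin mulr_ge0.
- by apply: emeasurable_funM => //; exact/measurable_EFinP.
have mpcE : measurable_fun setT (fun x => (pol x * c x)%:E) by exact/measurable_EFinP.
have pcE0 x : setT x -> (0 <= (pol x * c x)%:E)%E by rewrite lee_fin.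
apply: leeD2l; rewrite (ge0_integralZl F measurableT mpcE pcE0) ?lee_fin//.
by rewrite EFinM lee_wpmul2l// lee_fin.
Qed.

End Duality.

Lemma eq_ogd_prefix (R : realType) (V rho : R) (T : nat) (v p v' p' : nat -> R) (n : nat) :
  (forall t, (0 < t <= n)%N -> v t = v' t /\ p t = p' t) ->
  ogd_prefix V rho T v p n = ogd_prefix V rho T v' p' n.
Proof.
elim: n => [//|n IH] vp; rewrite !ogd_prefixS IH; last first.
  by move=> t /andP[t0 tn]; apply: vp; rewrite t0 ltnW.
by have [ev ep] := vp n.+1 (leqnn _); rewrite /ogd_step ev ep.
Qed.

Lemma mutually_independent_comp (d : measure_display) (Omega : measurableType d)
    (R : realType) (P : probability Omega R) (I : eqType) (s : seq I)
    (X : I -> Omega -> R) (f : R -> R) : measurable_fun setT f ->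
  mutually_independent P s X -> mutually_independent P s (fun i => f \o X i).
Proof.
move=> mf Xind B mB; apply: (Xind (fun i => f @^-1` B i)) => i.
by rewrite -[X in measurable X]setTI; exact: mf.
Qed.

Section ClippedRounds.
Context (d : measure_display) (Omega : measurableType d) (R : realType).
Context (P : probability Omega R) (F G : probability R R).
Variables (V rho : R) (T : nat) (v p : nat -> Omega -> R).
Hypotheses (V0 : 0 < V) (rho0 : 0 < rho) (rhoV : rho <= V) (T2 : (1 < T)%N).
Hypotheses (F1 : F `[0, V]%classic = 1%E) (G1 : G `[0, V]%classic = 1%E).
Hypothesis mv : forall t, measurable_fun setT (v t).
Hypothesis mp : forall t, measurable_fun setT (p t).
Hypothesis law_v : forall t, (1 <= t <= T)%N ->
  forall A, measurable A -> P (v t @^-1` A) = F A.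
Hypothesis law_p : forall t, (1 <= t <= T)%N ->
  forall A, measurable A -> P (p t @^-1` A) = G A.
Hypothesis vp_indep : mutually_independent P
  ([seq inl t | t <- iota 1 T] ++ [seq inr t | t <- iota 1 T]) (vp_family v p).

Let cv t w := clip V (v t w).
Let cp t w := clip V (p t w).

Let mc : measurable_fun setT (clip V). Proof. exact: measurable_clip. Qed.

Let mpre (A : set R) : measurable A -> measurable (clip V @^-1` A).
Proof. by move=> mA; rewrite -[X in measurable X]setTI; exact: mc. Qed.

Let mcv t : measurable_fun setT (cv t). Proof. exact: measurableT_comp. Qed.
Let mcp t : measurable_fun setT (cp t). Proof. exact: measurableT_comp. Qed.

Let law_cv t : (1 <= t <= T)%N -> forall A, measurable A -> P (cv t @^-1` A) = F A.
Proof.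
by move=> tT A mA; rewrite -(clip_law F1 mA) -(law_v tT) //; exact: mpre.
Qed.

Let law_cp t : (1 <= t <= T)%N -> forall A, measurable A -> P (cp t @^-1` A) = G A.
Proof.
by move=> tT A mA; rewrite -(clip_law G1 mA) -(law_p tT) //; exact: mpre.
Qed.

Let cvp_indep : mutually_independent P
  ([seq inl t | t <- iota 1 T] ++ [seq inr t | t <- iota 1 T]) (vp_family cv cp).
Proof.
have -> : vp_family cv cp = fun i => clip V \o vp_family v p i.
  by apply/funext => -[t|t].
exact: mutually_independent_comp.
Qed.

(** The deviations concern the clipped process; the remaining sets are null, and off them clipped
    and original rounds coincide, so the revenues agree. *)
Let bad (k : nat) : set Omega :=
  deviation_event F G V rho T cv cp (clipped_reward V) (clipped_cost V) k `|`
  (v k.+1 @^-1` (~` `[0, V]%classic) `|` p k.+1 @^-1` (~` `[0, V]%classic)).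

Let badP k : (k < T)%N ->
  measurable (bad k) /\ (P (bad k) <= (4 * expR (- (3 * ln T%:R)))%:E)%E.
Proof.
move=> kT; have mI : measurable (~` `[0, V]%classic : set R) by exact: measurableC.
have kT' : (1 <= k.+1 <= T)%N by [].
have mvo : measurable (v k.+1 @^-1` (~` `[0, V]%classic)).
  by rewrite -[X in measurable X]setTI; exact: mv.
have mpo : measurable (p k.+1 @^-1` (~` `[0, V]%classic)).
  by rewrite -[X in measurable X]setTI; exact: mp.
have cvb t w : 0 <= cv t w <= V by exact: clip_bound (ltW V0) _.
have cpb t w : 0 <= cp t w <= V by exact: clip_bound (ltW V0) _.
have [mD PD] := deviation_eventP rho V0 T2 mcv mcp law_cv law_cp cvp_indep
  (measurable_clipped_reward V) (measurable_clipped_cost V)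
  (clipped_reward_bound V0) (clipped_cost_bound V0) kT.
split; first by apply: measurableU => //; exact: measurableU.
apply: le_trans (measureU2 P mD (measurableU _ _ mvo mpo)) _.
rewrite -[leRHS]adde0; apply: leeD => //.
have Pv : (P (v k.+1 @^-1` (~` `[0%R, V]%classic)) <= 0)%E.
  by rewrite (law_v kT')// outside_itv_null.
have Pp : (P (p k.+1 @^-1` (~` `[0%R, V]%classic)) <= 0)%E.
  by rewrite (law_p kT')// outside_itv_null.
apply: le_trans (measureU2 P mvo mpo) _.
by rewrite -[leRHS]adde0; exact: leeD.
Qed.

Lemma regret_high_probability : exists A : set Omega,
  [/\ measurable A,
   A `<=` [set w | (OPT F G rho T - (ogd_revenue V rho T (v^~ w) (p^~ w))%:E <=
     (regret_const V rho * Num.sqrt (T%:R * ln T%:R))%:E)%E] &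
   ((1 - 4 / T%:R)%:E <= P A)%E].
Proof.
have T0 : 0 < T%:R :> R by rewrite ltr0n ltnW.
pose B := \big[setU/set0]_(k < T) bad k.
have mB : measurable B by apply: bigsetU_measurable => k _; case: (badP (ltn_ord k)).
exists (~` B); split; first exact: measurableC.
- move=> w nB /=.
  have nbad k : (k < T)%N -> ~ bad k w.
    by move=> kT bk; apply: nB; rewrite /B -bigcup_mkord; exists k.
  have in_itv t : (0 < t <= T)%N -> 0 <= v t w <= V /\ 0 <= p t w <= V.
    case: t => // t /nbad nb; split; apply: contrapT => no; apply: nb; right.
      by left => /=; rewrite in_itv.
    by right => /=; rewrite in_itv.
  have rev_eq : ogd_revenue V rho T (v^~ w) (p^~ w) = ogd_revenue V rho T (cv^~ w) (cp^~ w).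
    congr st_rev; apply: eq_ogd_prefix => t /in_itv[vI pI].
    by rewrite /cv /cp !clip_id.
  rewrite EFinN leeBlDr// -EFinD rev_eq; set bound := _ + _.
  (* [OPT] is T times a supremum, so the bound is divided by T and checked policy by policy. *)
  have -> : bound = T%:R * (bound / T%:R) by rewrite mulrC divfK// gt_eqF.
  rewrite /OPT EFinM lee_wpmul2l ?lee_fin ?ler0n//.
  apply: ge_ereal_sup => _ [pol [mpol [pol01 feas]] <-].
  have [om [-> omV dual]] := policy_dual V0 F1 G1 mpol pol01 feas.
  rewrite lee_fin ler_pdivlMr// mulrC -lerBlDr.
  apply: (@regret_off_deviations _ _ _ F G V rho T cv cp V0 rho0 rhoV T2 _ _
    (clipped_reward V) (clipped_cost V)) => //.
  - by move=> t w'; exact: clip_bound (ltW V0) _.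
  - by move=> t w'; exact: clip_bound (ltW V0) _.
  - exact: measurable_clipped_reward.
  - exact: measurable_clipped_cost.
  - exact: clipped_reward_bound.
  - exact: clipped_cost_bound.
  - by move=> x y xI yI; rewrite /clipped_reward /= !clip_id.
  - by move=> x y xI yI; rewrite /clipped_cost /= !clip_id.
  - by move=> k /nbad nb dev; apply: nb; left.
- rewrite probability_setC// EFinB; apply: leeB => //.
  apply: le_trans (Boole_inequality P (fun k kT => (badP kT).1)) _.
  apply: (@le_trans _ _ (\sum_(k < T) (4 * expR (- (3 * ln T%:R)))%:E)%E).
    by apply: lee_sum => k _; case: (badP (ltn_ord k)).
  rewrite sumEFin lee_fin sumr_const card_ord.
  (* The T bad events have probability at most 4 T^-3 each, in total 4 / T^2 <= 4 / T. *)
  rewrite expRN expRM_natl lnK ?posrE// -mulr_natl.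
  rewrite [leLHS](_ : _ = 4 / T%:R ^+ 2); last by field; rewrite gt_eqF.
  rewrite mulr1 ler_pM2l// lef_pV2 ?posrE ?exprn_gt0//.
  by rewrite expr2 ler_peMr ?(ltW T0)// ler1n ltnW.
Qed.

End ClippedRounds.

Theorem theorem6 (R : realType) (vbar rho : R) :
  0 < vbar -> 0 < rho -> rho <= vbar ->
  exists C : R, forall (T : nat) (d : measure_display) (Omega : measurableType d)
    (P : probability Omega R) (F G : probability R R) (v p : nat -> Omega -> R),
    (0 < T)%N ->
    F `[0, vbar]%classic = 1%E -> G `[0, vbar]%classic = 1%E ->
    (forall t, measurable_fun setT (v t)) ->
    (forall t, measurable_fun setT (p t)) ->
    (forall t, (1 <= t <= T)%N -> forall A, measurable A -> P (v t @^-1` A) = F A) ->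
    (forall t, (1 <= t <= T)%N -> forall A, measurable A -> P (p t @^-1` A) = G A) ->
    mutually_independent P ([seq inl t | t <- iota 1 T] ++ [seq inr t | t <- iota 1 T])
      (vp_family v p) ->
    exists A : set Omega, measurable A /\
      A `<=` [set w | (OPT F G rho T
                        - (ogd_revenue vbar rho T (fun t => v t w) (fun t => p t w))%:E
                        <= (C * Num.sqrt (T%:R * ln T%:R))%:E)%E] /\
      ((1 - 4 / T%:R)%:E <= P A)%E.
Proof.
move=> V0 rho0 rhoV; exists (regret_const vbar rho).
move=> T d Omega P F G v p T0 F1 G1 mv mp law_v law_p indep.
(* For T = 1 the required probability is -3 and the empty event suffices; T >= 2 makes ln T
   positive. *)
have [T2|T1] := ltnP 1 T; last first.
  exists set0; split; first exact: measurable0; split; first exact: sub0set.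
  have -> : T = 1%N by apply/eqP; rewrite eqn_leq T1 T0.
  by rewrite measure0 lee_fin divr1; lra.
have [A [mA Asub PA]] :=
  regret_high_probability V0 rho0 rhoV T2 F1 G1 mv mp law_v law_p indep.
by exists A.
Qed.
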